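(* Let $d\ge1$ and let $\Phi$ be a nonconstant scalar rational inner function on $\mathbb D^d$, analytic on a neighbourhood of $\overline{\mathbb D}^d$. Then \[ \liminf_{m\to\infty}\log D_m\ge\frac{h(\Phi)}{2\Lambda(\Phi)} . \] Equivalently, \[ \liminf_{m\to\infty}D_m\ge\exp\!\left(\frac{h(\Phi)}{2\Lambda(\Phi)}\right). \] The resulting lower bound $\exp\bigl(h(\Phi)/(2\Lambda(\Phi))\bigr)$ exceeds one precisely when $\Phi$ is not a monomial.
   Context: A scalar rational inner function on $\mathbb D^d$ is a rational function $\Phi$, holomorphic on $\mathbb D^d$, with $|\Phi|=1$ (almost everywhere) on $\mathbb T^d$. Here $\Phi$ is analytic on a neighbourhood of the closed polydisc; write its Taylor expansion as $\Phi(z)=\sum_{\alpha\in\mathbb N_0^d}c_\alpha z^\alpha$, so that $\sum_\alpha|c_\alpha|^2=1$. ''Monomial'' means that $\Phi$ has exactly one nonzero Taylor coefficient, i.e. $\Phi$ is a unimodular constant times $z^\alpha$. Define the coefficient entropy and the radial index \[ h(\Phi)=-\sum_\alpha|c_\alpha|^2\log|c_\alpha|^2\quad(0\log0=0),\qquad \Lambda(\Phi)=\limsup_{u\downarrow1}\frac{\log\|\Phi(u\,\cdot)\|_{L^\infty(\mathbb T^d)}}{\log u}. \] (For nonconstant $\Phi$ one has $0<\Lambda(\Phi)<\infty$ and $h(\Phi)<\infty$.) For integers $m,n\ge1$, $D_{m,n}$ is the supremum of $\|a(P)\|_{q_m}/\|P\|_\infty$ over nonzero $m$-homogeneous polynomials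 $P(z)=\sum_{|\alpha|=m}a_\alpha z^\alpha$ on $\mathbb C^n$, where $q_m=\frac{2m}{m+1}$, $\|a(P)\|_p=(\sum_\alpha|a_\alpha|^p)^{1/p}$, $\|P\|_\infty=\sup_{\mathbb D^n}|P|$; and $D_m=\sup_{n\ge1}D_{m,n}<\infty$. *)

(* Defs.v *)
From HB Require Import structures.
From mathcomp Require Import all_boot all_order all_algebra finmap complex.
From mathcomp Require Import all_classical all_reals all_analysis.
(* The notations of mpoly clash with those of all_analysis. *)
From mathcomp Require Import -(notations) mpoly.

Set Implicit Arguments.
Unset Strict Implicit.
Unset Printing Implicit Defensive.

Import Order.TTheory GRing.Theory Num.Theory.
Import numFieldNormedType.Exports.

Local Open Scope classical_set_scope.
Local Open Scope complex_scope.
Local Open Scope ring_scope.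

Section Analytic.
Variables (R : realType) (d : nat).

(* R[i]^o carries the topology of the numFieldType R[i]; normc is the
   R-valued modulus, whereas `|z| lives in R[i]. *)
Local Notation point := 'rV[R[i]^o]_d.
Local Notation normc := (@Normc.normc R).

Definition polydisc : set point := [set z | forall j, normc (z 0 j) < 1].
Definition closed_polydisc : set point :=
  [set z | forall j, normc (z 0 j) <= 1].

Definition mpoly_eval (P : mpoly d R[i]) (z : point) : R[i] :=
  meval (fun j => z 0 j) P.

Definition monomial_at (h : point) (a : multinom d) : R[i] :=
  \prod_(j < d) (h 0 j : R[i]) ^+ a j.

(* Unconditional convergence, which over R[i] is absolute convergence. *)
Definition has_sum (I : choiceType) (F : I -> R[i]) (s : R[i]) : Prop :=
  forall e : R, 0 < e -> exists A : {fset I}, forall B : {fset I},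
    fsubset A B -> normc (\sum_(i <- enum_fset B) F i - s) < e.

Definition is_power_series_at (f : point -> R[i]) (w : point)
    (c : multinom d -> R[i]) : Prop :=
  exists2 r : R, 0 < r & forall h : point, (forall j, normc (h 0 j) < r) ->
    has_sum (fun a => c a * monomial_at h a) (f (w + h)).

Definition analytic_on (U : set point) (f : point -> R[i]) : Prop :=
  forall w, U w -> exists c, is_power_series_at f w c.

Definition analytic_near_closed_polydisc (f : point -> R[i]) : Prop :=
  exists U : set point,
    [/\ open U, closed_polydisc `<=` U & analytic_on U f].

Definition rational_on (U : set point) (f : point -> R[i]) : Prop :=
  exists P Q : mpoly d R[i], Q != 0 /\
    forall z, U z -> mpoly_eval Q z != 0 ->
      f z = mpoly_eval P z / mpoly_eval Q z.

(* Lebesgue null sets of R^d. *)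
Definition lebesgue_null (A : set ('I_d -> R)) : Prop :=
  forall e : R, 0 < e -> exists a b : nat -> 'I_d -> R,
    [/\ forall k j, a k j <= b k j,
        A `<=` \bigcup_k [set t | forall j, a k j <= t j <= b k j]
      & (\sum_(0 <= k <oo) (\prod_(j < d) (b k j - a k j))%:E <= e%:E)%E].

Definition torus_point (t : 'I_d -> R) : point :=
  \row_j (cos (t j) +i* sin (t j)).

Definition torus_ae (P : point -> Prop) : Prop :=
  lebesgue_null [set t | (forall j, 0 <= t j <= 2 * pi) /\
                         ~ P (torus_point t)].

Definition torus_Linfty (f : point -> R[i]) : \bar R :=
  ereal_inf [set y : \bar R | torus_ae (fun z => ((normc (f z))%:E <= y)%E)].

Definition rational_inner (f : point -> R[i]) : Prop :=
  [/\ rational_on polydisc f, analytic_on polydisc f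
    & torus_ae (fun z => normc (f z) = 1)].

Definition constant_on_polydisc (f : point -> R[i]) : Prop :=
  exists k, forall z, polydisc z -> f z = k.

(* The coefficients at the origin; they are unique when f is analytic there. *)
Definition taylor_coef (f : point -> R[i]) : multinom d -> R[i] :=
  xget (fun=> 0) [set c | is_power_series_at f 0 c].

Definition is_monomial (f : point -> R[i]) : Prop :=
  exists! a, taylor_coef f a <> 0.

(* ln 0 = 0, and the summands are nonnegative since every coefficient of an
   inner function has modulus at most 1. *)
Definition coef_entropy (f : point -> R[i]) : \bar R :=
  \esum_(a in [set: multinom d])
    (- (normc (taylor_coef f a) ^+ 2 * ln (normc (taylor_coef f a) ^+ 2)))%:E.

Definition dilate (u : R) (z : point) : point :=
  \row_j (u%:C * (z 0 j : R[i])).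

Definition radial_index (f : point -> R[i]) : \bar R :=
  limf_esup
    (fun u : R => lne (torus_Linfty (fun z => f (dilate u z))) / (ln u)%:E)%E
    (at_right (1 : R)).

End Analytic.

Section BohnenblustHille.
Variable R : realType.
Local Notation normc := (@Normc.normc R).

Definition coef_norm (n : nat) (p : R) (P : mpoly n R[i]) : R :=
  (\sum_(a <- msupp P) normc (mcoeff a P) `^ p) `^ p^-1.

Definition polydisc_norm (n : nat) (P : mpoly n R[i]) : R :=
  sup [set normc (mpoly_eval P z) | z in @polydisc R n].

Definition bh_exponent (m : nat) : R := (2 * m)%:R / m.+1%:R.

Definition bh_const_dim (m n : nat) : \bar R :=
  ereal_sup [set (coef_norm (bh_exponent m) P / polydisc_norm P)%:E
            | P in [set P : mpoly n R[i] | P \is ishomog1 m mdeg /\ P <> 0]].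

Definition bh_const (m : nat) : \bar R :=
  ereal_sup [set bh_const_dim m n | n in [set n | (1 <= n)%N]].

End BohnenblustHille.

(* Main.v *)
(* Let c be the Taylor coefficients of Phi at 0. Compactness of the closed
   polydisc makes the local expansions of Phi uniform, so the series at 0
   converges on a polydisc of radius > 1; hence |Phi| = 1 on the whole torus and
   |c|^2 is a probability distribution with entropy h. Fix L2 > L1 > Lambda and
   u > 1 with |Phi(u z)| <= u^L1 on the torus. Homogenize, with one more
   variable, the part of degree <= m of the N-fold tensor power
   Phi(z_1) ... Phi(z_N), where N = floor(m / L2). Cauchy's estimates at radius u
   bound the part of degree > m by u^(L1 N - m), up to a constant factor, so the
   polynomial has sup norm 1 + o(1), and likewise the removed coefficients carry
   a vanishing l^2 mass. For b = |coefficient|^2 one has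
   |coefficient|^(2m/(m+1)) = b exp(-log(b)/(m+1)), and -log b averages to N h, so
   by convexity the sum of these powers is at least exp(h/L2) - o(1). Its power
   (m+1)/(2m) tends to exp(h/(2 L2)).
   Cauchy's estimates and Parseval's identity are obtained by averaging over
   roots of unity; no contour integral is used. *)

Require Import Defs.
From HB Require Import structures.
From mathcomp Require Import all_boot all_order all_algebra cyclic separable cyclotomic finmap.
From mathcomp Require Import complex ring lra.
From mathcomp Require Import all_classical all_reals all_analysis measurable_realfun.
From mathcomp Require Import -(notations) mpoly.

Set Implicit Arguments.
Unset Strict Implicit.
Unset Printing Implicit Defensive.

Import Order.TTheory GRing.Theory Num.Theory.
Import numFieldNormedType.Exports.

Local Open Scope classical_set_scope.
Local Open Scope complex_scope.
Local Open Scope ring_scope.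

(** The radial index acts as the degree of one tensor factor. At radius u the N-fold power has
    modulus at most u^(L1 N), so everything above degree m is exponentially small once N L1 stays
    below m by a fixed proportion; the gap between L1 and L2 provides that proportion. The radius u
    is fixed before m grows, so the factor 1/(u - 1) of the geometric tail is a constant.

    The entropy enters through 2m/(m+1) = 2 - 2/(m+1): the exponent is so close to 2 that one factor
    changes the sum by only exp(O(1/m)), but N factors multiply up to exp(N h/(m+1)), and N/(m+1)
    tends to 1/L2.

    The obstacle is that -log b is unbounded on the support, so a small mass above degree m could
    still carry a large share of the entropy. Hence only the indices of a finite set B are credited
    with their surprisal. This credit is bounded, the loss above degree m is then negligible, and B
    is arbitrary. *)

Section Modulus.
Variable R : realType.
Local Notation normc := (@Normc.normc R).
Implicit Types (x y : R[i]).

Lemma normcE x : (normc x)%:C = `|x|.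
Proof. by rewrite normc_def; case: x. Qed.

Lemma normc_ge0 x : 0 <= normc x.
Proof. by case: x => a b; rewrite sqrtr_ge0. Qed.

Lemma normc_eq0 x : (normc x == 0) = (x == 0).
Proof.
apply/eqP/eqP => [/Normc.eq0_normc //|->]; exact: Normc.normc0.
Qed.

Lemma normc_gt0 x : (0 < normc x) = (x != 0).
Proof. by rewrite lt_def normc_ge0 andbT normc_eq0. Qed.

Lemma normcX x n : normc (x ^+ n) = normc x ^+ n.
Proof.
elim: n => [|n IH]; first by rewrite !expr0 Normc.normc1.
by rewrite !exprS Normc.normcM IH.
Qed.

Lemma normcR (r : R) : normc r%:C = `|r|.
Proof. by rewrite /= expr0n addr0 sqrtr_sqr. Qed.

Lemma normc_sub x y : normc (x - y) = normc (y - x).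
Proof. by rewrite -normcN opprB. Qed.

Lemma le_normcB x y : normc (x - y) <= normc x + normc y.
Proof. by rewrite -(normcN y); exact: le_normcD. Qed.

Lemma le_normc_sum (I : Type) (s : seq I) (P : pred I) (F : I -> R[i]) :
  normc (\sum_(i <- s | P i) F i) <= \sum_(i <- s | P i) normc (F i).
Proof.
elim/big_ind2: _ => // [|x1 x2 y1 y2 h1 h2]; first by rewrite Normc.normc0.
by apply: (le_trans (le_normcD _ _)); exact: lerD.
Qed.

Lemma normc_prod (I : Type) (s : seq I) (P : pred I) (F : I -> R[i]) :
  normc (\prod_(i <- s | P i) F i) = \prod_(i <- s | P i) normc (F i).
Proof. by elim/big_rec2: _ => [|i y1 y2 _ <-]; rewrite ?Normc.normc1 ?Normc.normcM. Qed.

Lemma sqr_normcE x : (normc x ^+ 2)%:C = x * x^*.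
Proof. by rewrite rmorphXn /= normcE sqr_normc. Qed.

End Modulus.

(** * Parseval's identity on the torus *)

Section Parseval.
Variable R : realType.
Local Notation C := R[i].
Local Notation normc := (@Normc.normc R).

Definition mono (A : comNzRingType) n (z : 'I_n -> A) (a : multinom n) : A :=
  \prod_j z j ^+ a j.

Lemma normc_mono n (z : 'I_n -> C) (a : multinom n) :
  normc (mono z a) = \prod_j normc (z j) ^+ a j.
Proof. by rewrite normc_prod; apply: eq_bigr => j _; rewrite normcX. Qed.

Lemma prod_expr_mdeg (K : comNzRingType) n (r : K) (a : multinom n) :
  \prod_j r ^+ a j = r ^+ mdeg a.
Proof. by rewrite mdegE expr_sum. Qed.

Lemma normc_mono_cst n (z : 'I_n -> C) (r : R) (a : multinom n) :
  (forall j, normc (z j) = r) -> normc (mono z a) = r ^+ mdeg a.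
Proof.
by move=> zr; rewrite normc_mono -prod_expr_mdeg; apply: eq_bigr => j _; rewrite zr.
Qed.

Lemma normc_mono_le n (z : 'I_n -> C) (r : R) (a : multinom n) :
  (forall j, normc (z j) <= r) -> normc (mono z a) <= r ^+ mdeg a.
Proof.
move=> zr; rewrite normc_mono -prod_expr_mdeg; apply: ler_prod => j _.
by rewrite exprn_ge0 ?normc_ge0 //= lerXn2r ?nnegrE ?normc_ge0 // (le_trans _ (zr j)) ?normc_ge0.
Qed.

(** X^K - 1 splits over the algebraically closed [C] and is separable, so it has K distinct roots,
    and K distinct K-th roots of unity always include a primitive one. *)
Lemma prim_root_exists K : (0 < K)%N -> exists w : C, K.-primitive_root w.
Proof.
pose p : {poly C} := 'X^K - 1; have [r Dp] := closed_field_poly_normal p.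
move=> K_gt0; rewrite (monicP _) ?monicXnsubC // scale1r in Dp.
have rn1: all K.-unity_root r by apply/allP=> z; rewrite -root_prod_XsubC -Dp.
have sz_r: (K < (size r).+1)%N.
  by rewrite -(size_prod_XsubC r id) -Dp size_XnsubC.
have [|z] := hasP (has_prim_root K_gt0 rn1 _ sz_r); last by exists z.
by rewrite -separable_prod_XsubC -Dp separable_Xn_sub_1 // pnatr_eq0 -lt0n.
Qed.

Lemma normc_unity_root K (w : C) : (0 < K)%N -> w ^+ K = 1 -> normc w = 1.
Proof.
move=> K0 wK; apply/eqP; rewrite -(eqrXn2 K0) ?normc_ge0 // expr1n.
by rewrite -normcX wK Normc.normc1.
Qed.

Lemma sum_unity_root K (x : C) : (0 < K)%N -> x ^+ K = 1 ->
  \sum_(k < K) x ^+ k = if x == 1 then K%:R else 0.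
Proof.
move=> K0 xK; case: eqP => [->|/eqP x1].
  by under eq_bigr do rewrite expr1n; rewrite sumr_const card_ord.
have := subrX1 x K; rewrite xK subrr => /esym/eqP.
by rewrite mulf_eq0 subr_eq0 (negPf x1) => /eqP.
Qed.

(** The integer whose base-[D] digits are [a]; it is the exponent of w in a monomial after Kronecker
    substitution. *)
Definition radix (D n : nat) (a : 'I_n -> nat) : nat := \sum_(j < n) a j * D ^ j.

Lemma radix_recl D n (a : 'I_n.+1 -> nat) :
  radix D a = (a ord0 + D * radix D (fun j => a (lift ord0 j)))%N.
Proof.
rewrite /radix big_ord_recl expn0 muln1 big_distrr /=; congr addn.
by apply: eq_bigr => j _; rewrite /bump /= add1n expnS mulnCA.
Qed.

Lemma radix_inj D n (a b : 'I_n -> nat) : (forall j, a j < D)%N ->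
  (forall j, b j < D)%N -> radix D a = radix D b -> a =1 b.
Proof.
elim: n a b => [|n IH] a b aD bD; first by move=> _ [].
rewrite !radix_recl => e.
have D0 : (0 < D)%N by apply: leq_ltn_trans (aD ord0).
have e0 : a ord0 = b ord0.
  have := congr1 (modn^~ D) e.
  by rewrite /= addnC [in RHS]addnC ![(D * _)%N]mulnC !modnMDl !modn_small.
have e1 : radix D (fun j => a (lift ord0 j)) = radix D (fun j => b (lift ord0 j)).
  by move: e; rewrite e0 => /addnI /eqP; rewrite eqn_pmul2l // => /eqP.
have IH' := IH _ _ (fun j => aD (lift ord0 j)) (fun j => bD (lift ord0 j)) e1.
by move=> j; case: (unliftP ord0 j) => [j'|] ->; [exact: IH'|].
Qed.

Lemma radix_lt D n (a : 'I_n -> nat) : (forall j, a j < D)%N ->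
  (radix D a < D ^ n)%N.
Proof.
elim: n a => [|n IH] a aD; first by rewrite /radix big_ord0.
rewrite radix_recl expnS; have := IH _ (fun j => aD (lift ord0 j)).
have := aD ord0; move: (radix _ _) (a _) (D ^ n)%N => x y z yD xz.
by apply: (@leq_trans (D + D * x)); rewrite ?ltn_add2r // -mulnS leq_mul2l xz orbT.
Qed.

(* Kronecker substitution z_j = w^(D^j) reduces the torus to roots of unity. *)
Lemma parseval_unity_roots n (s : seq (multinom n)) : uniq s ->
  exists K (w : 'I_K.+1 -> 'I_n -> C), (forall k j, normc (w k j) = 1) /\
    forall c : multinom n -> C,
    \sum_k normc (\sum_(a <- s) c a * mono (w k) a) ^+ 2 =
    K.+1%:R * \sum_(a <- s) normc (c a) ^+ 2.
Proof.
(* All exponents occurring in [s] are digits in base [D], so distinct multi-indices give distinct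
   powers of w modulo D^n. *)
move=> us; pose D := (\max_(a <- s) mdeg a).+1.
have sD a j : a \in s -> (a j < D)%N.
  move=> sa; rewrite ltnS; apply: (@leq_trans (mdeg a)); last first.
    by rewrite (big_rem a) //= leq_maxl.
  by rewrite mdegE (bigD1 j) //= leq_addr.
have K0 : (0 < D ^ n)%N by rewrite expn_gt0.
have [w pw] := prim_root_exists K0.
have wK := prim_expr_order pw.
have w1 : normc w = 1 by exact: normc_unity_root wK.
have wJ : w * w^* = 1 by rewrite -sqr_normcE w1 expr1n.
have w0 : w != 0 by rewrite -normc_gt0 w1.
exists (D ^ n).-1; rewrite prednK // => {K0}.
exists (fun k j => w ^+ (k * D ^ j)); split=> [k j|c].
  by rewrite normcX w1 expr1n.
have monoE k a : mono (fun j => w ^+ (k * D ^ j)) a = (w ^+ radix D a) ^+ k.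
  rewrite /mono -exprM /radix mulnC big_distrr /= expr_sum.
  by apply: eq_bigr => j _; rewrite -exprM mulnCA mulnC mulnA mulnC.
(* The k-th power of [x a b] is the monomial of a times the conjugate monomial of b at the k-th
   sample point. Summed over k it vanishes unless [x a b] is 1, that is, unless a = b. *)
pose x (a b : multinom n) := w ^+ radix D a * (w^* ) ^+ radix D b.
have xK a b : x a b ^+ (D ^ n) = 1.
  by rewrite /x exprMn exprAC wK expr1n mul1r exprAC -rmorphXn /= wK rmorph1 expr1n.
have x1 a b : a \in s -> b \in s -> (x a b == 1) = (a == b).
  move=> sa sb; apply/eqP/eqP => [|->]; last by rewrite /x -exprMn wJ expr1n.
  move=> /(congr1 (fun y => y * w ^+ radix D b)).
  rewrite /x -mulrA -exprMn [_^* * _]mulrC wJ expr1n mulr1 mul1r => /eqP.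
  rewrite (eq_prim_root_expr pw) !modn_small ?radix_lt //; try by move=> j; apply: sD.
  by move=> /eqP /radix_inj e; apply/mnmP; apply: e => j; apply: sD.
apply: (@complexI R); rewrite rmorph_sum rmorphM rmorph_nat rmorph_sum /=.
have sqE (k : 'I_(D ^ n)) :
    (normc (\sum_(a <- s) c a * mono (fun j => w ^+ (k * D ^ j)) a) ^+ 2)%:C =
    \sum_(a <- s) \sum_(b <- s) c a * (c b)^* * x a b ^+ k.
  rewrite sqr_normcE rmorph_sum /= big_distrlr /=.
  apply: eq_bigr => a _; apply: eq_bigr => b _.
  by rewrite rmorphM /= !monoE /x exprMn !rmorphXn /=; ring.
under eq_bigr do rewrite sqE.
rewrite exchange_big mulr_sumr /= big_seq [RHS]big_seq.
apply: eq_bigr => a sa; rewrite exchange_big /=.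
under eq_bigr => b _ do rewrite -mulr_sumr sum_unity_root ?xK ?expn_gt0 //.
rewrite (bigD1_seq a) //= x1 // eqxx big1_seq ?addr0 => [|b /andP[ba sb]].
  by rewrite sqr_normcE mulrC.
by rewrite x1 // eq_sym (negPf ba) mulr0.
Qed.

(** Parseval for the rescaled coefficients c_a r^|a|: an average of squared moduli over sample
    points of the torus of radius r is at most the square of the supremum. *)
Lemma sum_sqr_coef_le n (s : seq (multinom n)) (c : multinom n -> C) (r S : R) :
  uniq s -> 0 <= r ->
  (forall z, (forall j, normc (z j) = r) ->
     normc (\sum_(a <- s) c a * mono z a) <= S) ->
  \sum_(a <- s) (normc (c a) * r ^+ mdeg a) ^+ 2 <= S ^+ 2.
Proof.
move=> us r0 fS; have [K [w [w1 /(_ (fun a => c a * (r ^+ mdeg a)%:C)) wE]]] :=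
  parseval_unity_roots us.
have K0 : 0 < K.+1%:R :> R by rewrite ltr0n.
under eq_bigr do
  rewrite -{1}(ger0_norm (exprn_ge0 _ r0)) -normcR -Normc.normcM.
have sS : K.+1%:R * S ^+ 2 = \sum_(k < K.+1) S ^+ 2.
  by rewrite sumr_const card_ord mulr_natl.
rewrite -(ler_pM2l K0) -wE sS.
apply: ler_sum => k _; rewrite lerXn2r ?nnegrE ?normc_ge0 //.
  by apply: le_trans (normc_ge0 _) (fS (fun=> r%:C) _) => j; rewrite normcR ger0_norm.
rewrite (le_trans _ (fS (fun j => r%:C * w k j) _)) //; last first.
  by move=> j; rewrite Normc.normcM w1 mulr1 normcR ger0_norm.
rewrite le_eqVlt; apply/orP; left; apply/eqP; congr normc; apply: eq_bigr => a _.
rewrite -mulrA; congr (_ * _); rewrite /mono -prod_expr_mdeg.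
rewrite rmorph_prod -big_split /=; apply: eq_bigr => j _.
by rewrite exprMn rmorphXn.
Qed.

Lemma sum_sqr_coef_ge n (s : seq (multinom n)) (c : multinom n -> C) (S : R) :
  uniq s -> 0 <= S ->
  (forall z, (forall j, normc (z j) = 1) ->
     S <= normc (\sum_(a <- s) c a * mono z a)) ->
  S ^+ 2 <= \sum_(a <- s) normc (c a) ^+ 2.
Proof.
move=> us S0 fS; have [K [w [w1 /(_ c) wE]]] := parseval_unity_roots us.
have K0 : 0 < K.+1%:R :> R by rewrite ltr0n.
have sS : K.+1%:R * S ^+ 2 = \sum_(k < K.+1) S ^+ 2.
  by rewrite sumr_const card_ord mulr_natl.
rewrite -(ler_pM2l K0) -wE sS.
apply: ler_sum => k _; rewrite lerXn2r ?nnegrE ?normc_ge0 //; exact: fS.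
Qed.

(** Cauchy's estimate, read off as a single term of Parseval's sum. *)
Lemma coef_le_sup n (s : seq (multinom n)) (c : multinom n -> C) (r S : R) a :
  uniq s -> 0 <= r -> a \in s ->
  (forall z, (forall j, normc (z j) = r) ->
     normc (\sum_(a <- s) c a * mono z a) <= S) ->
  normc (c a) * r ^+ mdeg a <= S.
Proof.
move=> us r0 sa fS; have := sum_sqr_coef_le us r0 fS.
have S0 : 0 <= S.
  by apply: le_trans (normc_ge0 _) (fS (fun=> r%:C) _) => j; rewrite normcR ger0_norm.
rewrite (bigD1_seq a) //= => h.
rewrite -(@ler_pXn2r _ 2) ?nnegrE ?mulr_ge0 ?normc_ge0 ?exprn_ge0 //.
by apply: le_trans h; rewrite lerDl sumr_ge0 // => b _; rewrite exprn_ge0 // mulr_ge0 ?normc_ge0 ?exprn_ge0.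
Qed.

End Parseval.

(** * Unconditional sums *)

Section HasSum.
Variable R : realType.
Local Notation C := R[i].
Local Notation normc := (@Normc.normc R).

Lemma sum_fsubset (V : zmodType) (I : choiceType) (F : I -> V) (A B : {fset I}) :
  fsubset A B -> \sum_(i <- enum_fset B | i \in A) F i = \sum_(i <- enum_fset A) F i.
Proof.
move=> /fsubsetP AB; rewrite -big_filter; apply: perm_big; apply: uniq_perm.
- by rewrite filter_uniq // fset_uniq.
- exact: fset_uniq.
by move=> i; rewrite mem_filter; case: (boolP (i \in A)) => // /AB.
Qed.

Lemma sum_fsubset_split (V : zmodType) (I : choiceType) (F : I -> V) (A B : {fset I}) :
  fsubset A B -> \sum_(i <- enum_fset B) F i =
  \sum_(i <- enum_fset A) F i + \sum_(i <- enum_fset (fsetD B A)) F i.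
Proof.
move=> AB; rewrite (bigID (mem A)) /= sum_fsubset //; congr (_ + _).
rewrite -big_filter; apply: perm_big; apply: uniq_perm.
- by rewrite filter_uniq // fset_uniq.
- exact: fset_uniq.
by move=> i; rewrite mem_filter in_fsetD.
Qed.

Lemma sum_fsubset_le (I : choiceType) (g : I -> R) (A B : {fset I}) :
  (forall i, 0 <= g i) -> fsubset A B ->
  \sum_(i <- enum_fset A) g i <= \sum_(i <- enum_fset B) g i.
Proof.
by move=> g0 AB; rewrite (sum_fsubset_split _ AB) lerDl sumr_ge0.
Qed.

Section Basic.
Variable I : choiceType.
Implicit Types (F G : I -> C) (s t : C).

Lemma has_sum_dist F s x (K : R) (A : {fset I}) : has_sum F s ->
  (forall B, fsubset A B -> normc (\sum_(i <- enum_fset B) F i - x) <= K) ->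
  normc (s - x) <= K.
Proof.
move=> Fs FK; apply/ler_addgt0Pr => e e0.
have [A' /(_ (fsetU A A'))] := Fs _ e0; rewrite fsubsetUr => /(_ isT) h.
have -> : s - x = (\sum_(i <- enum_fset (fsetU A A')) F i - x) -
   (\sum_(i <- enum_fset (fsetU A A')) F i - s) by ring.
apply: (le_trans (le_normcB _ _)); apply: lerD; last exact: ltW.
by apply: FK; rewrite fsubsetUl.
Qed.

Lemma has_sum_unique F s t : has_sum F s -> has_sum F t -> s = t.
Proof.
move=> Fs Ft; apply/eqP; rewrite -subr_eq0 -normc_eq0 eq_le normc_ge0 andbT.
apply/ler_addgt0Pr => e e0; rewrite add0r.
have [A FA] := Ft _ e0; apply: (@has_sum_dist _ _ _ _ A Fs) => B AB.
by apply: ltW; exact: FA.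
Qed.

Lemma has_sum_le F s (K : R) : has_sum F s ->
  (forall B : {fset I}, \sum_(i <- enum_fset B) normc (F i) <= K) -> normc s <= K.
Proof.
move=> Fs FK; rewrite -[s]subr0; apply: (@has_sum_dist _ _ _ _ fset0 Fs) => B _.
by rewrite subr0; apply: (le_trans (le_normc_sum _ _ _)).
Qed.

Lemma has_sum_tail F s (K : R) (A : {fset I}) : has_sum F s ->
  (forall B : {fset I}, [disjoint B & A]%fset ->
     \sum_(i <- enum_fset B) normc (F i) <= K) ->
  normc (s - \sum_(i <- enum_fset A) F i) <= K.
Proof.
move=> Fs FK; apply: (@has_sum_dist _ _ _ _ A Fs) => B AB.
rewrite (sum_fsubset_split _ AB) addrAC subrr add0r.
apply: (le_trans (le_normc_sum _ _ _)); apply: FK.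
by apply/fdisjointP => i; rewrite in_fsetD => /andP[].
Qed.

Lemma eq_has_sum F G s : F =1 G -> has_sum F s -> has_sum G s.
Proof.
by move=> FG Fs e /Fs[A FA]; exists A => B /FA; under eq_bigr do rewrite FG.
Qed.

Lemma has_sumD F G s t : has_sum F s -> has_sum G t ->
  has_sum (fun i => F i + G i) (s + t).
Proof.
move=> Fs Gt e e0; have e2 : 0 < e / 2 by lra.
have [A FA] := Fs _ e2; have [B GB] := Gt _ e2.
exists (fsetU A B) => D; rewrite fsubUset => /andP[/FA hA /GB hB].
rewrite big_split /= opprD addrACA; apply: (le_lt_trans (le_normcD _ _)).
by rewrite [e]splitr ltrD.
Qed.

Lemma has_sumZ F s k : has_sum F s -> has_sum (fun i => k * F i) (k * s).
Proof.
move=> Fs e e0; have [->|k0] := eqVneq k 0.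
  exists fset0 => B _; rewrite mul0r subr0 big1 ?Normc.normc0 // => i _.
  by rewrite mul0r.
have k1 : 0 < normc k by rewrite normc_gt0.
have [A FA] := Fs (e / normc k) (divr_gt0 e0 k1).
exists A => B /FA; rewrite -mulr_sumr -mulrBr Normc.normcM ltr_pdivlMr //.
by rewrite mulrC.
Qed.

Lemma has_sumB F G s t : has_sum F s -> has_sum G t ->
  has_sum (fun i => F i - G i) (s - t).
Proof.
move=> Fs /(has_sumZ (-1)) Gt; rewrite -[- t]mulN1r.
by apply: eq_has_sum (has_sumD Fs Gt) => i; rewrite mulN1r.
Qed.

Lemma has_sum_fin F (A : {fset I}) : (forall i, i \notin A -> F i = 0) ->
  has_sum F (\sum_(i <- enum_fset A) F i).
Proof.
move=> FA e e0; exists A => B AB; rewrite (sum_fsubset_split _ AB) addrAC subrr add0r.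
rewrite big1_seq ?Normc.normc0 // => i /andP[_]; rewrite in_fsetD => /andP[iA _].
exact: FA.
Qed.

Lemma has_sum_bounded F s : has_sum F s -> exists M, forall i, normc (F i) <= M.
Proof.
move=> Fs; have [A FA] := Fs _ ltr01.
(* Such a term is the difference of the partial sums over [A] with and without [i], and both lie
   within 1 of [s]. *)
have term0 i : i \notin A -> normc (F i) <= 2.
  move=> iA.
  have := FA (fsetU (fset1 i) A); rewrite fsubsetUr => /(_ isT).
  rewrite (sum_fsubset_split F (fsubsetUr (fset1 i) A)).
  have -> : fsetD (fsetU (fset1 i) A) A = fset1 i.
    apply/fsetP => j; rewrite !inE; case: (eqVneq j i) => [->|]; first by rewrite iA.
    by rewrite /= andNb.
  rewrite big_seq_fset1; have := FA A (fsubset_refl _).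
  set x := _ - s => h1; rewrite -addrA [F i + _]addrC addrA -/x => h2.
  have -> : F i = (x + F i) - x by ring.
  apply: (le_trans (le_normcB _ _)); lra.
exists (2 + \sum_(i <- enum_fset A) normc (F i)) => i.
case: (boolP (i \in A)) => [iA|/term0 h].
  rewrite (big_fsetD1 i) //=; have : 0 <= \sum_(j <- enum_fset (fsetD A (fset1 i))) normc (F j).
    by apply: sumr_ge0 => j _; exact: normc_ge0.
  lra.
have : 0 <= \sum_(j <- enum_fset A) normc (F j).
  by apply: sumr_ge0 => j _; exact: normc_ge0.
lra.
Qed.

Lemma has_sum_ge0 (g : I -> R) (K : R) : (forall i, 0 <= g i) ->
  (forall B : {fset I}, \sum_(i <- enum_fset B) g i <= K) ->
  exists s : R, has_sum (fun i => (g i)%:C) s%:C.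
Proof.
move=> g0 gK; pose S := [set \sum_(i <- enum_fset B) g i | B in [set: {fset I}]].
have supS : has_sup S.
  split; first by exists (\sum_(i <- enum_fset fset0) g i); exists fset0.
  by exists K => _ [B _ <-].
exists (sup S) => e e0; have [_ [A _ <-] hA] := sup_adherent e0 supS.
exists A => B AB; rewrite -rmorph_sum -rmorphB normcR.
have h1 := sum_fsubset_le g0 AB.
have h2 : \sum_(i <- enum_fset B) g i <= sup S.
  by apply: sup_upper_bound => //; exists B.
rewrite ler0_norm; lra.
Qed.

Lemma normc_ge_ReIm (x : C) : `|complex.Re x| <= normc x /\ `|complex.Im x| <= normc x.
Proof.
case: x => a b /=; split; rewrite -sqrtr_sqr ler_sqrt ?addr_ge0 ?sqr_ge0 //.
  by rewrite lerDl sqr_ge0.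
by rewrite lerDr sqr_ge0.
Qed.

Lemma summable_has_sum F (K : R) :
  (forall B : {fset I}, \sum_(i <- enum_fset B) normc (F i) <= K) ->
  exists s, has_sum F s.
Proof.
move=> FK.
have real_case (f : I -> R) : (forall i, `|f i| <= normc (F i)) ->
    exists s : C, has_sum (fun i => (f i)%:C) s.
  move=> fF.
  (* A real family is written as (|f| + f) - |f|, a difference of nonnegative families with bounded
     partial sums. *)
  have [|B|s hs] := @has_sum_ge0 (fun i => `|f i|) K; first by [].
    by apply: le_trans (FK B); apply: ler_sum.
  have [i|B|t ht] := @has_sum_ge0 (fun i => `|f i| + f i) (K + K).
  - by have := ler_norm (- f i); rewrite normrN; lra.
  - rewrite big_split /=; apply: lerD.
      by apply: le_trans (FK B); apply: ler_sum.
    apply: le_trans (FK B); apply: ler_sum => i _.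
    exact: le_trans (ler_norm _) (fF i).
  exists (t%:C - s%:C); apply: eq_has_sum (has_sumB ht hs) => i.
  by rewrite rmorphD /=; ring.
have [|s hs] := real_case (fun i => complex.Re (F i)); first by move=> i; case: (normc_ge_ReIm (F i)).
have [|t ht] := real_case (fun i => complex.Im (F i)); first by move=> i; case: (normc_ge_ReIm (F i)).
exists (s + 'i * t); apply: eq_has_sum (has_sumD hs (has_sumZ 'i ht)) => i.
by rewrite -complexE.
Qed.

End Basic.

Lemma has_sum_bij (I J : choiceType) (f : J -> I) (g : I -> J) (F : I -> C) s :
  cancel f g -> cancel g f -> has_sum F s -> has_sum (F \o f) s.
Proof.
move=> fK gK Fs e /Fs[A FA]; exists [fset g i | i in A]%fset => B AB.
have -> : \sum_(j <- enum_fset B) (F \o f) j = \sum_(i <- enum_fset [fset f j | j in B]%fset) F i.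
  rewrite -(big_map f xpredT F); apply: perm_big; apply: uniq_perm.
  - by rewrite map_inj_uniq ?fset_uniq //; exact: can_inj fK.
  - exact: fset_uniq.
  move=> i; apply/mapP/imfsetP => /= -[j jB ->]; by exists j.
apply: FA; apply/fsubsetP => i iA; apply/imfsetP; exists (g i) => //=.
by apply: (fsubsetP AB); apply/imfsetP; exists i.
Qed.

Lemma has_sum_sigma (I J : choiceType) (F : I * J -> C) (G : I -> C) T :
  has_sum F T -> (forall i, has_sum (fun j => F (i, j)) (G i)) -> has_sum G T.
Proof.
move=> FT FG e e0; have e2 : 0 < e / 2 by lra.
have [A0 FA] := FT _ e2.
exists [fset p.1 | p in A0]%fset => B AB.
pose n := size (enum_fset B); pose e3 := e / 2 / n.+1%:R.
have e30 : 0 < e3 by rewrite divr_gt0.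
have [D0 hD0] := choice (fun i => FG i _ e30).
(* Each row is cut far enough out for its own sum and also contains the second components of [A0],
   so that the pairs over [B] include [A0]. The row errors [e3] add up to at most e / 2. *)
pose D i := fsetU (D0 i) [fset p.2 | p in A0]%fset.
pose P := [fset p in flatten [seq [seq (i, j) | j <- enum_fset (D i)] | i <- enum_fset B]]%fset.
have uP : uniq (flatten [seq [seq (i, j) | j <- enum_fset (D i)] | i <- enum_fset B]).
  apply: allpairs_uniq_dep => [|i _|]; rewrite ?fset_uniq //.
  by move=> [i j] [i' j'] _ _ /= [-> ->].
have sumP : \sum_(p <- enum_fset P) F p =
    \sum_(i <- enum_fset B) \sum_(j <- enum_fset (D i)) F (i, j).
  transitivity (\sum_(p <- [seq (i, j) | i <- enum_fset B, j <- enum_fset (D i)]) F p).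
    by apply: perm_big; apply: uniq_perm => // p; rewrite inE.
  by rewrite big_allpairs_dep.
have hP : normc (\sum_(p <- enum_fset P) F p - T) < e / 2.
  apply: FA; apply/fsubsetP => -[i j] pA; rewrite inE /=.
  apply/allpairsPdep; exists i, j; split=> //.
    by apply: (fsubsetP AB); apply/imfsetP; exists (i, j).
  by rewrite inE; apply/orP; right; apply/imfsetP; exists (i, j).
have -> : \sum_(i <- enum_fset B) G i - T = (\sum_(p <- enum_fset P) F p - T) -
    \sum_(i <- enum_fset B) (\sum_(j <- enum_fset (D i)) F (i, j) - G i).
  by rewrite sumP sumrB; ring.
apply: (le_lt_trans (le_normcB _ _)); rewrite [e]splitr; apply: ltr_leD => //.
apply: (le_trans (le_normc_sum _ _ _)).
apply: (@le_trans _ _ (\sum_(i <- enum_fset B) e3)).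
  by apply: ler_sum => i _; apply: ltW; apply: hD0; exact: fsubsetUl.
rewrite big_const_seq count_predT iter_addr addr0 -/n -[e3 *+ n]mulr_natr /e3.
by rewrite mulrAC ler_pdivrMr ?ltr0n // ler_pM2l // ler_nat.
Qed.

(** Fubini: absolute summability over pairs gives an unconditional sum there, and both iterated sums
    equal it. *)
Lemma has_sum_exchange (I J : choiceType) (F : I -> J -> C) (G : I -> C) (H : J -> C) S (K : R) :
  (forall B : {fset I * J}, \sum_(p <- enum_fset B) normc (F p.1 p.2) <= K) ->
  (forall i, has_sum (F i) (G i)) -> (forall j, has_sum (fun i => F i j) (H j)) ->
  has_sum G S -> has_sum H S.
Proof.
move=> FK FG FH GS.
have [T FT] := summable_has_sum (F := fun p => F p.1 p.2) FK.
have -> : S = T by apply: has_sum_unique GS _; exact: has_sum_sigma FT FG.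
pose sw (X Y : choiceType) (p : X * Y) := (p.2, p.1).
have FT' : has_sum (fun p : J * I => F p.2 p.1) T.
  by apply: (has_sum_bij (f := @sw J I) (g := @sw I J)) FT => -[].
exact: has_sum_sigma FT' FH.
Qed.

End HasSum.

(** * Power series with geometrically decaying coefficients *)

Section Multiindex.
Variable n : nat.

Definition mnm_of K (f : {ffun 'I_n -> 'I_K}) : multinom n :=
  Multinom [tuple (f j : nat) | j < n].

Lemma mnm_ofE K (f : {ffun 'I_n -> 'I_K}) j : mnm_of f j = f j.
Proof. exact: mnmE. Qed.

Lemma mnm_of_inj K : injective (@mnm_of K).
Proof.
move=> f g /mnmP fg; apply/ffunP => j; apply: val_inj.
by have := fg j; rewrite !mnm_ofE.
Qed.

Definition box K : {fset multinom n} :=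
  [fset a in [seq mnm_of f | f <- enum {:{ffun 'I_n -> 'I_K}}]]%fset.

Lemma in_box K (a : multinom n) : (a \in box K) = [forall j, (a j < K)%N].
Proof.
rewrite inE /=; apply/mapP/forallP => [[f _ ->] j|aK]; first by rewrite mnm_ofE.
exists [ffun j => Ordinal (aK j)]; first by rewrite mem_enum.
by apply/mnmP => j; rewrite mnm_ofE ffunE.
Qed.

Lemma sum_box (V : zmodType) K (G : multinom n -> V) :
  \sum_(a <- enum_fset (box K)) G a = \sum_(f : {ffun 'I_n -> 'I_K}) G (mnm_of f).
Proof.
rewrite -[RHS]big_enum -(big_map (@mnm_of K) xpredT G) /=.
apply: perm_big; apply: uniq_perm; first exact: fset_uniq.
  by rewrite map_inj_uniq ?enum_uniq //; exact: mnm_of_inj.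
by move=> a; rewrite inE.
Qed.

Lemma mdeg_ge (a : multinom n) j : (a j <= mdeg a)%N.
Proof. by rewrite mdegE (bigD1 j) //= leq_addr. Qed.

Lemma box_mdeg K (a : multinom n) : (mdeg a < K)%N -> a \in box K.
Proof. by move=> aK; rewrite in_box; apply/forallP => j; apply: leq_ltn_trans aK; exact: mdeg_ge. Qed.

Lemma fset_sub_box (B : {fset multinom n}) : exists K, fsubset B (box K).
Proof.
exists (\max_(a <- enum_fset B) mdeg a).+1; apply/fsubsetP => a aB.
by apply: box_mdeg; rewrite ltnS (big_rem a) //= leq_maxl.
Qed.

Definition binm (a b : multinom n) : nat := \prod_j 'C(a j, b j).

Lemma binm_eq0 (a b : multinom n) : binm a b <> 0%N -> forall j, (b j <= a j)%N.
Proof.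
move=> ab j; rewrite leqNgt; apply/negP => lt; apply: ab.
by rewrite /binm (bigD1 j) //= bin_small.
Qed.

(** The binomial theorem in each coordinate, multiplied out. The truncated difference [mnm_sub a b]
    is harmless since [binm a b] is 0 unless b <= a coordinatewise; this allows one fixed box of
    summation. *)
Lemma monoD (A : comNzRingType) (z h : 'I_n -> A) (a : multinom n) K : a \in box K ->
  mono (fun j => z j + h j) a =
  \sum_(b <- enum_fset (box K)) (binm a b)%:R * mono z (mnm_sub a b) * mono h b.
Proof.
rewrite in_box => /forallP aK; rewrite sum_box /mono.
transitivity (\prod_(j < n) \sum_(k < K) 'C(a j, k)%:R * z j ^+ (a j - k) * h j ^+ k).
  apply: eq_bigr => j _; rewrite exprDn.
  rewrite (big_ord_widen_cond K xpredT (fun k => z j ^+ (a j - k) * h j ^+ k *+ 'C(a j, k))) //.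
  rewrite big_mkcond /=; apply: eq_bigr => k _; rewrite -mulr_natl mulrA.
  by case: ltnP => // ak; rewrite bin_small // !mul0r.
rewrite bigA_distr_bigA /=; apply: eq_bigr => f _.
rewrite !big_split /= natr_prod; congr (_ * _ * _).
- by apply: eq_bigr => j _; rewrite mnm_ofE.
- by apply: eq_bigr => j _; rewrite mnmBE mnm_ofE.
by apply: eq_bigr => j _; rewrite mnm_ofE.
Qed.

Lemma mono_cst (A : comNzRingType) (r : A) (a : multinom n) : mono (fun=> r) a = r ^+ mdeg a.
Proof. exact: prod_expr_mdeg. Qed.

Lemma mono_mnm_sub (A : comNzRingType) (z : 'I_n -> A) (a b : multinom n) :
  (forall j, (b j <= a j)%N) -> mono z (mnm_sub a b) * mono z b = mono z a.
Proof.
move=> ba; rewrite -big_split /=; apply: eq_bigr => j _.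
by rewrite -exprD mnmBE subnK.
Qed.

Variable R : realType.

Lemma sum_binm_expr (r s : R) (a : multinom n) K : a \in box K ->
  \sum_(b <- enum_fset (box K)) (binm a b)%:R * r ^+ mdeg (mnm_sub a b) * s ^+ mdeg b =
  (r + s) ^+ mdeg a.
Proof.
move=> aK; rewrite -mono_cst (monoD (fun=> r) (fun=> s) aK).
by apply: eq_bigr => b _; rewrite !mono_cst.
Qed.

Lemma sum_expr_mdeg_le (x : R) (B : {fset multinom n}) : 0 <= x < 1 ->
  \sum_(a <- enum_fset B) x ^+ mdeg a <= ((1 - x)^-1) ^+ n.
Proof.
move=> /andP[x0 x1]; have [K BK] := fset_sub_box B.
apply: (le_trans (sum_fsubset_le _ BK)) => [a|]; first exact: exprn_ge0.
rewrite sum_box.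
have -> : \sum_(f : {ffun 'I_n -> 'I_K}) x ^+ mdeg (mnm_of f) =
    \prod_(j < n) \sum_(k < K) x ^+ k.
  rewrite bigA_distr_bigA /=; apply: eq_bigr => f _.
  by rewrite -prod_expr_mdeg; apply: eq_bigr => j _; rewrite mnm_ofE.
rewrite prodr_const card_ord; apply: lerXn2r; rewrite ?nnegrE ?invr_ge0 ?subr_ge0 ?(ltW x1) //.
  by apply: sumr_ge0 => k _; exact: exprn_ge0.
rewrite -[leRHS]mul1r ler_pdivlMr ?subr_gt0 // mulrC.
have -> : (1 - x) * \sum_(k < K) x ^+ k = 1 - x ^+ K.
  by have := subrX1 x K; rewrite -[X in _ = X -> _]opprK -mulNr opprB => e; rewrite -[RHS]opprB e opprK.
by rewrite lerBlDr lerDl exprn_ge0.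
Qed.

End Multiindex.

Section Decay.
Variables (R : realType) (n : nat).
Local Notation C := R[i].
Local Notation normc := (@Normc.normc R).
Implicit Types (c : multinom n -> C) (z h w : 'I_n -> C).

(** The bounds of Cauchy at radius [s]. They give absolute and uniform convergence at every smaller
    radius, and can be propagated without any integral. *)
Definition decay c (M s : R) := forall a, normc (c a) * s ^+ mdeg a <= M.

Lemma decay_ge0 c M s : 0 < s -> decay c M s -> 0 <= M.
Proof.
move=> s0 /(_ (@mnm0 n)); apply: le_trans.
by rewrite mulr_ge0 ?normc_ge0 ?exprn_ge0 ?ltW.
Qed.

Lemma decay_le c M s M' s' : 0 < s' -> s' <= s -> M <= M' -> decay c M s -> decay c M' s'.
Proof.
move=> s0 ss MM cM a; apply: le_trans MM; apply: le_trans (cM a).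
by rewrite ler_wpM2l ?normc_ge0 // lerXn2r ?nnegrE ?(ltW s0) // (le_trans (ltW s0)).
Qed.

Lemma decay_term c M s r a : 0 < s -> 0 <= r -> decay c M s ->
  normc (c a) * r ^+ mdeg a <= M * (r / s) ^+ mdeg a.
Proof.
move=> s0 r0 cM.
have -> : normc (c a) * r ^+ mdeg a = normc (c a) * s ^+ mdeg a * (r / s) ^+ mdeg a.
  by rewrite -mulrA -exprMn mulrCA divff ?mulr1 // gt_eqF.
by rewrite ler_wpM2r // exprn_ge0 // divr_ge0 // ltW.
Qed.

Lemma decay_sum c M s r (B : {fset multinom n}) : 0 < s -> 0 <= r < s -> decay c M s ->
  \sum_(a <- enum_fset B) normc (c a) * r ^+ mdeg a <= M * ((1 - r / s)^-1) ^+ n.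
Proof.
move=> s0 /andP[r0 rs] cM; have M0 := decay_ge0 s0 cM.
apply: (@le_trans _ _ (\sum_(a <- enum_fset B) M * (r / s) ^+ mdeg a)).
  by apply: ler_sum => a _; exact: decay_term.
rewrite -mulr_sumr ler_wpM2l // sum_expr_mdeg_le //.
by rewrite divr_ge0 ?(ltW s0) //= ltr_pdivrMr // mul1r.
Qed.

(** The radius t between r and s splits (r/s)^|a| into (r/t)^|a|, which is summable, and (t/s)^|a|,
    which is at most (t/s)^K on [B]. *)
Lemma decay_tail c M s r t K (B : {fset multinom n}) :
  0 <= r < t -> t < s -> decay c M s -> (forall a, a \in B -> (K <= mdeg a)%N) ->
  \sum_(a <- enum_fset B) normc (c a) * r ^+ mdeg a <=
  M * ((1 - r / t)^-1) ^+ n * (t / s) ^+ K.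
Proof.
move=> /andP[r0 rt] ts cM BK.
have t0 : 0 < t by apply: le_lt_trans rt.
have s0 : 0 < s by apply: lt_trans ts.
have M0 := decay_ge0 s0 cM.
have ts1 : 0 <= t / s <= 1.
  by rewrite divr_ge0 ?(ltW s0) ?(ltW t0) //= ler_pdivrMr // mul1r ltW.
apply: (@le_trans _ _ (\sum_(a <- enum_fset B) M * (t / s) ^+ K * (r / t) ^+ mdeg a)).
  rewrite big_seq [leRHS]big_seq; apply: ler_sum => a aB.
  apply: (le_trans (decay_term a s0 r0 cM)); rewrite -mulrA ler_wpM2l //.
  have -> : r / s = t / s * (r / t).
    by rewrite mulrACA [t * r]mulrC mulrACA divff ?gt_eqF // mulr1 // mulrC.
  rewrite exprMn ler_wpM2r ?exprn_ge0 ?divr_ge0 ?(ltW t0) //.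
  by apply: ler_wiXn2l; [case/andP: ts1|case/andP: ts1|exact: BK].
rewrite -mulr_sumr -!mulrA ler_wpM2l // mulrC ler_wpM2r ?exprn_ge0 //; first by case/andP: ts1.
rewrite sum_expr_mdeg_le //.
by rewrite divr_ge0 ?(ltW t0) //= ltr_pdivrMr // mul1r.
Qed.

Lemma normc_term_le c z r a : (forall j, normc (z j) <= r) ->
  normc (c a * mono z a) <= normc (c a) * r ^+ mdeg a.
Proof.
by move=> zr; rewrite Normc.normcM ler_wpM2l ?normc_ge0 // normc_mono_le.
Qed.

Lemma decay_has_sum c M s r z : 0 < s -> 0 <= r < s -> decay c M s ->
  (forall j, normc (z j) <= r) -> exists v, has_sum (fun a => c a * mono z a) v.
Proof.
move=> s0 rs cM zr; apply: (@summable_has_sum _ _ _ (M * ((1 - r / s)^-1) ^+ n)) => B.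
apply: le_trans (decay_sum B s0 rs cM); apply: ler_sum => a _; exact: normc_term_le.
Qed.

Lemma decay_trunc c M s r t K z v (A : {fset multinom n}) :
  0 <= r < t -> t < s -> decay c M s -> (forall j, normc (z j) <= r) ->
  (forall a, (mdeg a < K)%N -> a \in A) ->
  has_sum (fun a => c a * mono z a) v ->
  normc (v - \sum_(a <- enum_fset A) c a * mono z a) <=
  M * ((1 - r / t)^-1) ^+ n * (t / s) ^+ K.
Proof.
move=> rt ts cM zr AK hv; apply: (has_sum_tail hv) => B BA.
apply: le_trans (decay_tail (B := B) rt ts cM _).
  by apply: ler_sum => a _; exact: normc_term_le.
move=> a aB; rewrite leqNgt; apply/negP => /AK aA.
by move/fdisjointP : BA => /(_ _ aB); rewrite aA.
Qed.

Lemma geom_small (k x e : R) : 0 <= x < 1 -> 0 < e -> exists K, forall K', (K <= K')%N ->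
  k * x ^+ K' <= e.
Proof.
move=> /andP[x0 x1] e0.
have [k0|k0] := leP k 0.
  by exists 0%N => K' _; apply: le_trans (ltW e0); rewrite mulr_le0_ge0 // exprn_ge0.
have := @cvg_expr R x; rewrite ger0_norm // => /(_ x1) /cvgr0Pnorm_lt /(_ (e / k) (divr_gt0 e0 k0)).
case=> K _ hK; exists K => K' KK; have := hK K' KK.
by rewrite ger0_norm ?exprn_ge0 // ltr_pdivlMr // mulrC => /ltW.
Qed.

Lemma decay_trunc_small c M s r e : 0 <= r < s -> decay c M s -> 0 < e ->
  exists K, forall K' z v, (K <= K')%N -> (forall j, normc (z j) <= r) ->
  has_sum (fun a => c a * mono z a) v ->
  normc (v - \sum_(a <- enum_fset (box n K')) c a * mono z a) <= e.
Proof.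
move=> /andP[r0 rs] cM e0; pose t := (r + s) / 2.
have rt : 0 <= r < t by rewrite /t; apply/andP; split=> //; lra.
have ts : t < s by rewrite /t; lra.
have s0 : 0 < s by exact: le_lt_trans rs.
have ts1 : 0 <= t / s < 1.
  by rewrite ltr_pdivrMr // mul1r ts andbT divr_ge0 //; rewrite /t; lra.
have [K hK] := geom_small (M * ((1 - r / t)^-1) ^+ n) ts1 e0.
exists K => K' z v KK zr hv; apply: le_trans (hK _ KK).
by apply: (decay_trunc rt ts cM zr _ hv) => a; exact: box_mdeg.
Qed.

Lemma decay_sqr_sum_le c M s r S (B : {fset multinom n}) : 0 < r < s -> decay c M s ->
  (forall z v, (forall j, normc (z j) = r) -> has_sum (fun a => c a * mono z a) v ->
     normc v <= S) ->
  \sum_(a <- enum_fset B) (normc (c a) * r ^+ mdeg a) ^+ 2 <= S ^+ 2.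
Proof.
move=> /andP[r0 rs] cM hS; have s0 : 0 < s by exact: lt_trans rs.
have rs' : 0 <= r < s by rewrite ltW.
have S0 : 0 <= S.
  have [|v hv] := @decay_has_sum c M s r (fun=> r%:C) s0 rs' cM.
    by move=> j; rewrite normcR gtr0_norm.
  by apply: le_trans (normc_ge0 v) _; apply: hS hv => j; rewrite normcR gtr0_norm.
(* Parseval is available for finite sums only. A large box approximates the series within e
   uniformly on the torus of radius r, which turns the bound S into S + e. *)
suff h e : 0 < e -> \sum_(a <- enum_fset B) (normc (c a) * r ^+ mdeg a) ^+ 2 <= (S + e) ^+ 2.
  set L := \sum_(a <- _) _ in h *.
  have L0 : 0 <= L by apply: sumr_ge0 => a _; exact: sqr_ge0.
  rewrite -(sqr_sqrtr L0) lerXn2r ?nnegrE ?sqrtr_ge0 //.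
  apply/ler_addgt0Pr => e e0; have := h e e0; rewrite -{1}(sqr_sqrtr L0).
  by rewrite ler_pXn2r // ?nnegrE ?sqrtr_ge0 // addr_ge0 // ltW.
move=> e0; have [K hK] := decay_trunc_small rs' cM e0.
have [K' BK'] := fset_sub_box B.
have BK2 : fsubset B (box n (maxn K K')).
  apply/fsubsetP => a /(fsubsetP BK'); rewrite !in_box => /forallP h; apply/forallP => j.
  by rewrite leq_max h orbT.
apply: (le_trans (sum_fsubset_le _ BK2)); first by move=> a; exact: sqr_ge0.
apply: sum_sqr_coef_le; rewrite ?fset_uniq ?(ltW r0) // => z zr.
have [|v hv] := @decay_has_sum c M s r z s0 rs' cM; first by move=> j; rewrite zr.
have := hS _ _ zr hv.
have := hK (maxn K K') z v (leq_maxl _ _) _ hv.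
move=> /(_ (fun j => eq_ind_r (fun x => x <= r) (lexx r) (zr j))).
set x := \sum_(a <- _) _ => h1 h2.
have -> : x = v - (v - x) by ring.
by apply: (le_trans (le_normcB _ _)); exact: lerD.
Qed.

Lemma decay_coef_le c M s r S a : 0 < r < s -> decay c M s ->
  (forall z v, (forall j, normc (z j) = r) -> has_sum (fun a => c a * mono z a) v ->
     normc v <= S) ->
  normc (c a) * r ^+ mdeg a <= S.
Proof.
move=> rs cM hS; have /andP[r0 rs'] := rs; have s0 : 0 < s by exact: lt_trans rs'.
have S0 : 0 <= S.
  have rs2 : 0 <= r < s by rewrite ltW.
  have [|v hv] := @decay_has_sum c M s r (fun=> r%:C) s0 rs2 cM.
    by move=> j; rewrite normcR gtr0_norm.
  by apply: le_trans (normc_ge0 v) _; apply: hS hv => j; rewrite normcR gtr0_norm.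
have := decay_sqr_sum_le (fset1 a) rs cM hS; rewrite big_seq_fset1.
by rewrite ler_pXn2r // nnegrE mulr_ge0 ?normc_ge0 ?exprn_ge0 ?ltW.
Qed.

(** The difference of the two series vanishes on a small torus, so Cauchy's estimate with bound 0
    kills every coefficient. The torus has radius [t2], strictly inside the radius [t] where the
    difference decays. *)
Lemma decay_unique c M s c' M' s' r : 0 < r -> 0 < s -> 0 < s' ->
  decay c M s -> decay c' M' s' ->
  (forall h, (forall j, normc (h j) <= r) -> exists v,
    has_sum (fun a => c a * mono h a) v /\ has_sum (fun a => c' a * mono h a) v) ->
  c =1 c'.
Proof.
move=> r0 s0 s'0 cM cM' cc a; pose t := Num.min (Num.min s s') r; pose t2 := t / 2.
have t0 : 0 < t by rewrite /t !lt_min s0 s'0.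
have t20 : 0 < t2 < t by rewrite /t2; apply/andP; split; lra.
have tr : t <= r by rewrite /t ge_min lexx orbT.
have ts : t <= s by rewrite /t !ge_min lexx.
have ts' : t <= s' by rewrite /t !ge_min lexx orbT.
have d : decay (fun a => c a - c' a) (M + M') t.
  move=> b; apply: (@le_trans _ _ ((normc (c b) + normc (c' b)) * t ^+ mdeg b)).
    by rewrite ler_wpM2r ?le_normcB ?exprn_ge0 // ltW.
  by rewrite mulrDl lerD //; apply: (decay_le t0 _ _ cM b) || apply: (decay_le t0 _ _ cM' b).
have /andP[t2p _] := t20.
have := @decay_coef_le _ _ _ _ 0 a t20 d.
have -> : (normc (c a - c' a) * t2 ^+ mdeg a <= 0) = (c a == c' a).
  by rewrite pmulr_lle0 ?exprn_gt0 // le_eqVlt ltNge normc_ge0 orbF normc_eq0 subr_eq0.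
move=> h; apply/eqP; apply: h => z v zt hv.
have [|u [hu hu']] := cc z.
  by move=> j; rewrite zt; move/andP: t20 => [_ /ltW /le_trans]; exact.
have -> : v = 0; last by rewrite Normc.normc0.
apply: (has_sum_unique hv); rewrite -(subrr u).
by apply: eq_has_sum (has_sumB hu hu') => b; rewrite mulrBl.
Qed.

End Decay.

(** * Convergence of the Taylor series beyond the closed polydisc *)

Section Recentre.
Variables (R : realType) (n : nat).
Local Notation C := R[i].
Local Notation normc := (@Normc.normc R).
Implicit Types (c : multinom n -> C) (z h w : 'I_n -> C).

Lemma sum_pairs_le (I J : choiceType) (g : I * J -> R) (B : {fset I * J})
    (A1 : {fset I}) (A2 : {fset J}) : (forall p, 0 <= g p) ->
  (forall p, p \in B -> p.1 \in A1 /\ p.2 \in A2) ->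
  \sum_(p <- enum_fset B) g p <=
  \sum_(i <- enum_fset A1) \sum_(j <- enum_fset A2) g (i, j).
Proof.
move=> g0 BA; pose s := [seq (i, j) | i <- enum_fset A1, j <- enum_fset A2].
have us : uniq s by apply: allpairs_uniq; rewrite ?fset_uniq // => -[i j] [i' j'] _ _.
have -> : \sum_(i <- enum_fset A1) \sum_(j <- enum_fset A2) g (i, j) =
    \sum_(p <- enum_fset [fset p in s]%fset) g p.
  rewrite -[LHS]big_allpairs; apply: perm_big.
  by apply: uniq_perm; rewrite ?fset_uniq // => p; rewrite inE.
apply: sum_fsubset_le => //; apply/fsubsetP => -[i j] /BA[/= iA jA].
by rewrite inE /=; apply/allpairsP; exists (i, j).
Qed.

(** Each row sums to (r + e)^|a| by the binomial theorem, which [decay] then controls because r + e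
    < s. This is the domination that permits rearranging a power series around a new centre. *)
Lemma sum_recentre_le c M s r e (B : {fset multinom n * multinom n}) :
  0 <= r -> 0 <= e -> r + e < s -> decay c M s ->
  \sum_(p <- enum_fset B) normc (c p.1) *
     ((binm p.1 p.2)%:R * r ^+ mdeg (mnm_sub p.1 p.2) * e ^+ mdeg p.2) <=
  M * ((1 - (r + e) / s)^-1) ^+ n.
Proof.
move=> r0 e0 res cM; have s0 : 0 < s by apply: le_lt_trans res; exact: addr_ge0.
have [K1 hK1] := fset_sub_box [fset p.1 | p in B]%fset.
have [K2 hK2] := fset_sub_box [fset p.2 | p in B]%fset.
pose K := maxn K1 K2.
have sub K' : (K' <= K)%N -> fsubset (box n K') (box n K).
  move=> KK; apply/fsubsetP => a; rewrite !in_box => /forallP h.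
  by apply/forallP => j; apply: leq_trans KK.
apply: le_trans (@sum_pairs_le _ _ _ B [fset p.1 | p in B]%fset (box n K) _ _) _ => /=.
- by move=> p; rewrite !mulr_ge0 ?normc_ge0 ?exprn_ge0 ?ler0n.
- move=> p pB; split; first by apply/imfsetP; exists p.
  apply: (fsubsetP (sub K2 (leq_maxr _ _))); apply: (fsubsetP hK2).
  by apply/imfsetP; exists p.
apply: le_trans (@decay_sum _ _ c M s (r + e) [fset p.1 | p in B]%fset s0 _ cM); last first.
  by rewrite addr_ge0.
rewrite big_seq [leRHS]big_seq; apply: ler_sum => a aB.
rewrite -mulr_sumr sum_binm_expr //.
by apply: (fsubsetP (sub K1 (leq_maxl _ _))); exact: (fsubsetP hK1).
Qed.

Lemma recentre c M s r e z : 0 <= r -> 0 < e -> r + e < s -> decay c M s ->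
  (forall j, normc (z j) <= r) ->
  exists A : multinom n -> C,
  [/\ decay A (M * ((1 - (r + e) / s)^-1) ^+ n) e,
      forall b, has_sum (fun a => c a * ((binm a b)%:R * mono z (mnm_sub a b))) (A b)
    & forall h v, (forall j, normc (h j) <= e) ->
        has_sum (fun a => c a * mono (fun j => z j + h j) a) v ->
        has_sum (fun b => A b * mono h b) v].
Proof.
move=> r0 e0 res cM zr; set K0 := M * _.
have hK0 := fun B => sum_recentre_le B r0 (ltW e0) res cM.
have normF a b : normc (c a * ((binm a b)%:R * mono z (mnm_sub a b))) <=
    normc (c a) * ((binm a b)%:R * r ^+ mdeg (mnm_sub a b)).
  rewrite !Normc.normcM ler_wpM2l ?normc_ge0 //.
  rewrite -(rmorph_nat (real_complex R)) normcR ger0_norm ?ler0n // ler_wpM2l ?ler0n //.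
  exact: normc_mono_le.
(* One column of the double sum: the pairs whose second component is [b]. *)
have colK b (B : {fset multinom n}) :
    \sum_(a <- enum_fset B) normc (c a * ((binm a b)%:R * mono z (mnm_sub a b))) * e ^+ mdeg b <= K0.
  pose s2 := [seq (a, b) | a <- enum_fset B].
  have us2 : uniq s2 by rewrite map_inj_uniq ?fset_uniq // => x y [].
  have := hK0 [fset p in s2]%fset.
  have -> : \sum_(p <- enum_fset [fset p in s2]%fset) normc (c p.1) *
     ((binm p.1 p.2)%:R * r ^+ mdeg (mnm_sub p.1 p.2) * e ^+ mdeg p.2) =
     \sum_(a <- enum_fset B) normc (c a) *
     ((binm a b)%:R * r ^+ mdeg (mnm_sub a b) * e ^+ mdeg b).
    rewrite -(big_map (fun a => (a, b)) xpredT (fun p => normc (c p.1) *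
     ((binm p.1 p.2)%:R * r ^+ mdeg (mnm_sub p.1 p.2) * e ^+ mdeg p.2))).
    by apply: perm_big; apply: uniq_perm => // p; rewrite inE.
  apply: le_trans; apply: ler_sum => a _; rewrite [leRHS]mulrA.
  by apply: ler_wpM2r; rewrite ?exprn_ge0 ?(ltW e0).
have ex b : exists v, has_sum (fun a => c a * ((binm a b)%:R * mono z (mnm_sub a b))) v.
  apply: (@summable_has_sum _ _ _ (K0 / e ^+ mdeg b)) => B.
  by rewrite ler_pdivlMr ?exprn_gt0 // mulr_suml.
have [A hA] := choice ex.
exists A; split => // [b|h v he hv].
  rewrite -ler_pdivlMr ?exprn_gt0 //; apply: (has_sum_le (hA b)) => B.
  by rewrite ler_pdivlMr ?exprn_gt0 // mulr_suml.
pose F a b := c a * ((binm a b)%:R * mono z (mnm_sub a b)) * mono h b.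
apply: (@has_sum_exchange _ _ _ F (fun a => c a * mono (fun j => z j + h j) a) _ _ K0) hv.
- move=> B; apply: le_trans (hK0 B); apply: ler_sum => -[a b] _ /=.
  rewrite /F Normc.normcM [leRHS]mulrA ler_pM ?normc_ge0 //.
  exact: normc_mono_le.
- move=> a; have aK := @box_mdeg n (mdeg a).+1 a (ltnSn _).
  rewrite (monoD _ _ aK) mulr_sumr.
  have -> : \sum_(b <- enum_fset (box n (mdeg a).+1)) c a * ((binm a b)%:R * mono z (mnm_sub a b) * mono h b)
     = \sum_(b <- enum_fset (box n (mdeg a).+1)) F a b.
    by apply: eq_bigr => b _; rewrite /F mulrA.
  apply: has_sum_fin => b bK; rewrite /F.
  have [->|/eqP ab] := eqVneq (binm a b) 0%N; first by rewrite !(mul0r, mulr0).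
  case/negP: bK; rewrite in_box; apply/forallP => j; rewrite ltnS.
  by apply: leq_trans (binm_eq0 ab j) _; exact: mdeg_ge.
move=> b; rewrite mulrC; apply: eq_has_sum (has_sumZ (mono h b) (hA b)) => a.
by rewrite /F mulrC.
Qed.

End Recentre.

Section Continuation.
Variables (R : realType) (n : nat) (f : ('I_n -> R[i]) -> R[i]).
Local Notation C := R[i].
Local Notation normc := (@Normc.normc R).
Implicit Types (c : multinom n -> C) (z h w : 'I_n -> C).

Definition expands c s := (exists M, decay c M s) /\
  forall w, (forall j, normc (w j) < s) -> has_sum (fun a => c a * mono w a) (f w).

Definition local_expansion z M e := exists2 a : multinom n -> C, decay a M e &
  forall h, (forall j, normc (h j) < e) ->
    has_sum (fun b => a b * mono h b) (f (fun j => z j + h j)).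

(** By uniqueness of coefficients, a local expansion at a point inside the polydisc is the recentred
    global one; its coefficients are therefore explicit sums in [c]. *)
Lemma recentre_local c s M e z r : expands c s -> 0 < s -> 0 < e -> 0 <= r < s ->
  (forall j, normc (z j) <= r) -> forall a,
  decay a M e -> (forall h, (forall j, normc (h j) < e) ->
    has_sum (fun b => a b * mono h b) (f (fun j => z j + h j))) ->
  forall b, has_sum (fun a => c a * ((binm a b)%:R * mono z (mnm_sub a b))) (a b).
Proof.
move=> [[M' cM'] cf] s0 e0 /andP[r0 rs] zr a aM af b.
pose e1 := (s - r) / 2; have e10 : 0 < e1 by rewrite /e1; lra.
have res : r + e1 < s by rewrite /e1; lra.
have [A [AM hA Af]] := recentre r0 e10 res cM' zr.
suff -> : a = A by exact: hA.
apply: funext; pose t := Num.min e1 (e / 2).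
have t0 : 0 < t by rewrite /t lt_min e10 /=; lra.
have te1 : t <= e1 by rewrite /t ge_min lexx.
have te : t <= e / 2 by rewrite /t ge_min lexx orbT.
apply: (decay_unique t0 e0 e10 aM AM) => h ht.
exists (f (fun j => z j + h j)); split; first by apply: af => j; have := ht j; lra.
apply: Af => [j|]; first by have := ht j; lra.
apply: cf => j; apply: le_lt_trans (le_normcD _ _) _.
have := ht j; have := zr j; lra.
Qed.

(** binm(a, b) r^|a-b| e^|b| is one term of the expansion of (r + e)^|a|, hence at most s^|a|. *)
Lemma binm_mono_decay c M s r e b : 0 < r -> 0 < e -> r + e <= s -> decay c M s ->
  decay (fun a => c a * (binm a b)%:R) (M * (r / e) ^+ mdeg b) r.
Proof.
move=> r0 e0 res cM a; have s0 : 0 < s by apply: lt_le_trans res; exact: addr_gt0.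
have M0 := decay_ge0 s0 cM.
rewrite Normc.normcM -(rmorph_nat (real_complex R)) normcR ger0_norm ?ler0n //.
have [->|/eqP ab] := eqVneq (binm a b) 0%N.
  by rewrite mulr0 mul0r mulr_ge0 // exprn_ge0 // divr_ge0 // ltW.
have ba := binm_eq0 ab.
rewrite expr_div_n mulrA ler_pdivlMr ?exprn_gt0 //.
have -> : r ^+ mdeg a = r ^+ mdeg (mnm_sub a b) * r ^+ mdeg b.
  by rewrite -!mono_cst mono_mnm_sub.
rewrite -!mulrA [r ^+ mdeg b * _]mulrC !mulrA ler_wpM2r ?exprn_ge0 ?(ltW r0) //.
apply: le_trans (cM a); rewrite -!mulrA ler_wpM2l ?normc_ge0 //.
apply: (@le_trans _ _ ((r + e) ^+ mdeg a)); last first.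
  by apply: lerXn2r; rewrite ?nnegrE ?(ltW s0) // addr_ge0 // ltW.
have aK := @box_mdeg n (mdeg a).+1 a (ltnSn _).
rewrite -(sum_binm_expr _ _ aK) (big_fsetD1 b) /=; last first.
  by rewrite in_box; apply/forallP => j; rewrite ltnS; apply: leq_trans (ba j) (mdeg_ge _ _).
by rewrite mulrA lerDl sumr_ge0 // => x _; rewrite !mulr_ge0 ?exprn_ge0 ?ler0n ?ltW.
Qed.

(* At a point of the torus of radius r the local coefficients are bounded by
   M e^-|b|; read back through the recentring formula this bounds
   binm(a, b) |c a|, and summing over b against (e/2)^|b| gives radius r + e/2. *)
Lemma expands_step c s M e r : expands c s -> 0 < r < s -> 0 < e ->
  (forall z, (forall j, normc (z j) <= r) -> local_expansion z M e) ->
  expands c (r + e / 2).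
Proof.
move=> cs rs e0 loc; have /andP[r0 rs'] := rs.
have s0 : 0 < s by exact: lt_trans rs'.
have [[M' cM'] cf] := cs.
have rs0 : 0 <= r < s by rewrite ltW.
have cb a b : normc (c a) * (binm a b)%:R * r ^+ mdeg (mnm_sub a b) * e ^+ mdeg b <= M.
  have [->|/eqP ab] := eqVneq (binm a b) 0%N.
    rewrite mulr0 !mul0r.
    have [|x xM _] := loc (fun=> 0); last exact: decay_ge0 xM.
    by move=> j; rewrite Normc.normc0 ltW.
  have ba := binm_eq0 ab.
  pose e1 := (s - r) / 2; have e10 : 0 < e1 by rewrite /e1; lra.
  have r1 : 0 < r + e1 / 2 by lra.
  have res : (r + e1 / 2) + e1 / 2 <= s by rewrite /e1; lra.
  have e20 : 0 < e1 / 2 by lra.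
  have rr : 0 < r < r + e1 / 2 by rewrite r0 ltrDl.
  have := decay_coef_le (S := M / e ^+ mdeg b * r ^+ mdeg b) a rr
    (binm_mono_decay b r1 e20 res cM').
  rewrite Normc.normcM -(rmorph_nat (real_complex R)) normcR ger0_norm ?ler0n //.
  have -> : r ^+ mdeg a = r ^+ mdeg (mnm_sub a b) * r ^+ mdeg b.
    by rewrite -!mono_cst mono_mnm_sub.
  rewrite mulrA ler_pM2r ?exprn_gt0 // ler_pdivlMr ?exprn_gt0 //.
  apply=> z v zr hv.
  have zr' j : normc (z j) <= r by rewrite zr.
  have [x xM xf] := loc z zr'.
  have hx := recentre_local cs s0 e0 rs0 zr' xM xf b.
  have -> : v = mono z b * x b.
    apply: (has_sum_unique hv).
    apply: eq_has_sum (has_sumZ (mono z b) hx) => a'.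
    have [->|/eqP ab'] := eqVneq (binm a' b) 0%N; first by rewrite !(mul0r, mulr0).
    by rewrite -(mono_mnm_sub z (binm_eq0 ab')); ring.
  rewrite Normc.normcM (normc_mono_cst _ zr) mulrC ler_wpM2r ?exprn_ge0 ?(ltW r0) //.
  by rewrite ler_pdivlMr ?exprn_gt0.
have M0 : 0 <= M.
  have [|x xM _] := loc (fun=> 0); last exact: decay_ge0 xM.
  by move=> j; rewrite Normc.normc0 ltW.
have cdec : decay c (M * ((1 - 2^-1)^-1) ^+ n) (r + e / 2).
  move=> a; have aK := @box_mdeg n (mdeg a).+1 a (ltnSn _).
  rewrite -(sum_binm_expr _ _ aK) mulr_sumr.
  apply: (@le_trans _ _ (\sum_(b <- enum_fset (box n (mdeg a).+1)) M * 2^-1 ^+ mdeg b)).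
    by apply: ler_sum => b _; rewrite exprMn !mulrA ler_wpM2r ?exprn_ge0.
  rewrite -mulr_sumr ler_wpM2l // sum_expr_mdeg_le //; apply/andP; split; lra.
split; first by eexists; exact: cdec.
move=> w ws; set s2 := r + e / 2 in cdec ws *.
have s20 : 0 < s2 by rewrite /s2; lra.
have [x /andP[x0 xs2] wx] : exists2 x, 0 < x < s2 & forall j, normc (w j) <= x.
  pose x := \big[Num.max/(s2 / 2)]_j normc (w j).
  exists x => [|j]; last exact: (@le_bigmax_cond _ _ _ _ j xpredT).
  rewrite (@lt_le_trans _ _ (s2 / 2)) ?bigmax_ge_id //=; last by lra.
  by apply: bigmax_lt => //; rewrite /s2; lra.
(* The decay of [c] shows that the series converges at w, not yet that its sum is [f w]. The point z
   on the segment from 0 to w has modulus below r, and w - z has modulus below s2 (1 - r/s2) = e/2.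
   Hence the local expansion at z reaches w, and it coincides with the recentred series. *)
pose z := fun j => (r / s2)%:C * w j; pose r1 := r / s2 * x; pose e1 := x * (1 - r / s2).
have q0 : 0 < r / s2 by rewrite divr_gt0.
have q1 : r / s2 < 1 by rewrite ltr_pdivrMr // mul1r /s2; lra.
have zr1 j : normc (z j) <= r1.
  by rewrite /z Normc.normcM normcR gtr0_norm // ler_wpM2l // ltW.
have r1r : r1 < r by rewrite /r1 mulrAC ltr_pdivrMr // ltr_pM2l.
have r10 : 0 <= r1 by rewrite /r1 mulr_ge0 // ltW.
have e10 : 0 < e1 by rewrite /e1 mulr_gt0 // subr_gt0.
have e1e : e1 < e.
  have : x * (1 - r / s2) < s2 * (1 - r / s2) by rewrite ltr_pM2r // subr_gt0.
  have -> : s2 * (1 - r / s2) = e / 2.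
    by rewrite mulrBr mulr1 mulrCA divff ?gt_eqF // mulr1 /s2; lra.
  rewrite /e1; lra.
have res : r1 + e1 < s2.
  by have -> : r1 + e1 = x by rewrite /r1 /e1; ring.
have [A [AM hA Af]] := recentre r10 e10 res cdec zr1.
have [y yM yf] := loc z (fun j => le_trans (zr1 j) (ltW r1r)).
have r1s : 0 <= r1 < s by rewrite r10 /=; lra.
have hy := recentre_local cs s0 e0 r1s zr1 yM yf.
have Ay b : A b = y b by apply: has_sum_unique (hA b) (hy b).
pose h j := w j - z j.
have he j : normc (h j) <= e1.
  have -> : h j = (1 - r / s2)%:C * w j by rewrite /h /z rmorphB rmorph1; ring.
  by rewrite Normc.normcM normcR gtr0_norm ?subr_gt0 // mulrC /e1 ler_wpM2r // subr_ge0 ltW.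
have zh : (fun j => z j + h j) = w by apply: funext => j; rewrite /h addrC subrK.
have xx : 0 <= x < s2 by rewrite ltW.
have [v hv] := decay_has_sum s20 xx cdec wx.
suff -> : f w = v by [].
rewrite -zh in hv *; apply: has_sum_unique (Af _ _ he hv).
apply: eq_has_sum (yf h _) => [b|j]; first by rewrite Ay.
exact: le_lt_trans (he j) e1e.
Qed.

Lemma expands_unit c M e : 0 < e -> e <= 1 -> expands c e ->
  (forall z, (forall j, normc (z j) <= 1) -> local_expansion z M e) ->
  exists2 s, 1 < s & expands c s.
Proof.
move=> e0 e1 ce loc.
(* While the radius s is at most 1, one step from r = s - e/4 reaches r + e/2 = s + e/4. The gain
   e/4 is the same each time because the local radius e is uniform. *)
suff H k : (exists2 s, 1 < s & expands c s) \/ expands c (e + k%:R * (e / 4)).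
  pose k := (Num.bound (4 / e)).+1.
  have [//|h] := H k; exists (e + k%:R * (e / 4)) => //.
  have := archi_boundP (ltW (divr_gt0 (ltr0n _ 4) e0)).
  rewrite ltr_pdivrMr // -/k => h4.
  have : (Num.bound (4 / e))%:R <= k%:R :> R by rewrite ler_nat.
  nra.
elim: k => [|k [|IH]]; [by right; rewrite mul0r addr0|by left|].
have [s1|s1] := ltP 1 (e + k%:R * (e / 4)); first by left; exists (e + k%:R * (e / 4)).
have ke : 0 <= k%:R * (e / 4) by rewrite mulr_ge0 ?ler0n //; lra.
right; set s := e + _ in IH s1 *.
have -> : e + k.+1%:R * (e / 4) = (s - e / 4) + e / 2.
  by rewrite /s -natr1; field.
have rs : 0 < s - e / 4 < s by apply/andP; split; rewrite /s; lra.
apply: (expands_step IH rs e0) => z zr; apply: loc => j.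
by apply: (le_trans (zr j)); lra.
Qed.

End Continuation.

(** * Uniform local expansions by compactness *)

Section LocalToGlobal.
Variables (R : realType) (n : nat).
Local Notation C := R[i].
Local Notation normc := (@Normc.normc R).
Local Notation point := 'rV[R[i]^o]_n.

Lemma normc_le_ReIm (x : C) : normc x <= `|complex.Re x| + `|complex.Im x|.
Proof.
case: x => a b /=; set y := `|a| + `|b|; have y0 : 0 <= y by exact: addr_ge0.
rewrite -(ger0_norm y0) -sqrtr_sqr ler_sqrt ?sqr_ge0 // sqrrD !real_normK ?num_real //.
by rewrite -addrA lerD2l lerDr mulrn_wge0 // mulr_ge0.
Qed.

Lemma polydisc_nbhs (z : point) (r : R) : 0 < r ->
  nbhs z [set w : point | forall j, normc (w 0 j - z 0 j) < r].
Proof.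
move=> r0; apply/nbhs_ballP; exists r%:C; first by rewrite /= ltcR.
move=> w [_ zw] j; have := zw 0 j; rewrite /ball /= -normcE ltcR.
by rewrite normc_sub.
Qed.

(** A compact set that contains the closed polydisc. With squares in place of discs, each factor is
    a continuous image of a product of two segments. *)
Lemma square_compact : compact [set w : point | forall j,
  `|complex.Re (w 0 j)| <= 1 /\ `|complex.Im (w 0 j)| <= 1].
Proof.
pose g (p : R * R) : R[i]^o := p.1 +i* p.2.
have gc : continuous g.
  move=> p; apply/cvgrPdist_lt => e e0.
  have eE : e = (complex.Re e)%:C.
    by move: e0; case: e => a b; rewrite ltcE /= => /andP[/eqP -> _].
  have r0 : 0 < complex.Re e / 2 by move: e0; rewrite eE ltcR /=; lra.
  exists (ball p.1 (complex.Re e / 2), ball p.2 (complex.Re e / 2)) => [|q [hq1 hq2] /=].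
    by split; exact: nbhsx_ballx.
  rewrite eE -normcE ltcR; apply: le_lt_trans (normc_le_ReIm _) _ => /=.
  by rewrite [ltRHS]splitr; exact: ltrD.
have Kc : compact (g @` (`[-1, 1] `*` `[-1, 1])).
  apply: continuous_compact; first exact: continuous_subspaceT.
  by apply: compact_setX; exact: segment_compact.
have := @rV_compact _ n (fun=> g @` (`[-1, 1] `*` `[-1, 1])) (fun=> Kc).
congr compact; apply/seteqP; split=> w hw j.
  have [[a b] [/= ha hb] <-] := hw j.
  by move: ha hb; rewrite !in_itv /= !ler_norml.
have [h1 h2] := hw j; exists (complex.Re (w 0 j), complex.Im (w 0 j)); last by case: (w 0 j).
by split; rewrite /= in_itv /= -ler_norml.
Qed.

Lemma power_series_decay (Phi : point -> C) (z : point) c :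
  is_power_series_at Phi z c -> exists2 r : R, 0 < r &
  expands (fun h => Phi (z + \row_j h j)) c r.
Proof.
move=> [r r0 hr].
have hr' (h : 'I_n -> C) : (forall j, normc (h j) < r) ->
    has_sum (fun a => c a * mono h a) (Phi (z + \row_j h j)).
  move=> hh; apply: eq_has_sum (hr (\row_j h j) _) => [a|j]; last by rewrite mxE.
  by congr (_ * _); apply: eq_bigr => j _; rewrite mxE.
have r2 : 0 < r / 2 by lra.
exists (r / 2) => //; split; last first.
  by move=> h hh; apply: hr' => j; have := hh j; lra.
have [|M hM] := has_sum_bounded (hr' (fun=> (r / 2)%:C) _).
  by move=> j; rewrite normcR gtr0_norm //; lra.
exists M => a; have := hM a; rewrite Normc.normcM mono_cst normcX normcR.
by rewrite gtr0_norm.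
Qed.

(** One integer controls both the coefficient bound and the inverse of the radius, so the claim is
    monotone in it and a covering argument along the filter of large integers applies. *)
Lemma uniform_local_expansion (Phi : point -> C) (U : set point) :
  open U -> @closed_polydisc R n `<=` U -> analytic_on U Phi ->
  exists N : nat, forall z : point, closed_polydisc z ->
    local_expansion (fun w => Phi (\row_j w j)) (fun j => z 0 j) N.+1%:R (N.+1%:R^-1).
Proof.
move=> oU KU an; pose f w := Phi (\row_j w j).
pose P (N : nat) (z : point) := closed_polydisc z ->
  local_expansion f (fun j => z 0 j) N.+1%:R (N.+1%:R^-1).
have /compact_near_coveringP cov := square_compact.
have [|N _ hN] := cov nat \oo P _.
  move=> z0 _; have [z0K|z0K] := pselect (closed_polydisc z0); last first.
    (* The compact square also has points outside the closed polydisc; near those the claim is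
       vacuous. *)
    have [j hj] : exists j, 1 < normc (z0 0 j).
      by apply: contrapT => h; apply: z0K => j; rewrite leNgt; apply/negP => ?; apply: h; exists j.
    have e0 : 0 < normc (z0 0 j) - 1 by lra.
    have := polydisc_nbhs z0 e0 => nb.
    exists ([set w : point | forall j0, normc (w 0 j0 - z0 0 j0) < normc (z0 0 j) - 1], setT).
      by split => //; exists 0%N.
    move=> [z N] /= [hz _] zK; exfalso.
    have := hz j; have := zK j; have := le_normcD (z 0 j) (z0 0 j - z 0 j).
    rewrite addrC subrK normc_sub; lra.
  have [c hc] := an z0 (KU _ z0K).
  have [r r0 [[M cM] cf]] := power_series_decay hc.
  have r4 : 0 < r / 4 by lra.
  have rr : r / 4 + r / 4 < r by lra.
  (* For z within r/4 of z0, recentring with radius r/4 stays inside r. The integer [N0] dominates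
     the new bound [M1] and 4/r. *)
  pose M1 := M * ((1 - (r / 4 + r / 4) / r)^-1) ^+ n.
  pose N0 := (Num.bound M1 + Num.bound (4 / r))%N.
  exists ([set w : point | forall j0, normc (w 0 j0 - z0 0 j0) < r / 4],
          [set N | (N0 <= N)%N]).
    by split; [exact: polydisc_nbhs|exists N0].
  move=> [z N] /= [hz hN] _.
  have [|A [AM _ Af]] := @recentre _ _ c M r (r / 4) (r / 4) (fun j => z 0 j - z0 0 j) (ltW r4) r4 rr cM.
    by move=> j; rewrite ltW.
  have M10 : 0 <= M1 := decay_ge0 r4 AM.
  have N1 : M1 <= N.+1%:R.
    apply: le_trans (ltW (archi_boundP M10)) _; rewrite ler_nat.
    by apply: leq_trans (leqW hN); exact: leq_addr.
  have N2 : N.+1%:R^-1 <= r / 4.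
    rewrite -[leRHS]invrK lef_pV2 ?posrE ?invr_gt0 ?ltr0n // invf_div.
    apply: le_trans (ltW (archi_boundP (ltW (divr_gt0 (ltr0n _ 4) r0)))) _.
    by rewrite ler_nat; apply: leq_trans (leqW hN); exact: leq_addl.
  exists A; first by apply: decay_le AM; rewrite ?invr_gt0 ?ltr0n.
  move=> h hh; have hr j : normc (h j) <= r / 4 by apply: le_trans (ltW (hh j)) N2.
  apply: Af => //.
  have := cf (fun j => (z 0 j - z0 0 j) + h j) _.
  have -> : z0 + \row_j (z 0 j - z0 0 j + h j) = \row_j (z 0 j + h j).
    by apply/rowP => j; rewrite !mxE addrA [z0 0 j + _]addrC subrK.
  apply => j; apply: le_lt_trans (le_normcD _ _) _.
  have := hz j; have := hr j; lra.
exists N => z zK; apply: hN => //= j; have [h1 h2] := normc_ge_ReIm (z 0 j).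
by split; [apply: le_trans h1 _|apply: le_trans h2 _]; exact: zK.
Qed.

Lemma analytic_expands (Phi : point -> C) c :
  analytic_near_closed_polydisc Phi -> is_power_series_at Phi 0 c ->
  exists2 s, 1 < s & expands (fun w => Phi (\row_j w j)) c s.
Proof.
move=> [U [oU KU an]] hc; have [N hN] := uniform_local_expansion oU KU an.
have [r r0 [[M cM] cf]] := power_series_decay hc.
pose e := Num.min r (N.+1%:R^-1).
have e0 : 0 < e by rewrite /e lt_min r0 invr_gt0 ltr0n.
have er : e <= r by rewrite /e ge_min lexx.
have eN : e <= N.+1%:R^-1 by rewrite /e ge_min lexx orbT.
apply: (@expands_unit _ _ _ c N.+1%:R e e0).
- by apply: le_trans eN _; rewrite invf_le1 ?ltr0n // ler1n.
- split; first by exists M; exact: decay_le cM.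
  move=> w hw; have := cf w (fun j => lt_le_trans (hw j) er).
  by rewrite add0r.
move=> z hz; have [|A AM Af] := hN (\row_j z j); first by move=> j; rewrite mxE.
exists A; first exact: decay_le AM.
move=> h hh; have := Af h (fun j => lt_le_trans (hh j) eN).
congr has_sum; congr Phi; by apply/rowP => j; rewrite !mxE.
Qed.

Lemma taylor_coef_series (Phi : point -> C) :
  analytic_near_closed_polydisc Phi -> is_power_series_at Phi 0 (taylor_coef Phi).
Proof.
move=> [U [_ KU an]]; have [|c hc] := an 0.
  by apply: KU => j; rewrite mxE Normc.normc0.
exact: (@xgetPex _ _ [set c | is_power_series_at Phi 0 c] (ex_intro _ c hc)).
Qed.

End LocalToGlobal.

(** * Null sets and the essential supremum on the torus *)

Section NullSets.
Variables (R : realType) (d : nat).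
Local Notation C := R[i].
Local Notation normc := (@Normc.normc R).
Local Notation point := 'rV[R[i]^o]_d.

Definition upd (t : 'I_d -> R) (j0 : 'I_d) (x : R) : 'I_d -> R :=
  fun j => if j == j0 then x else t j.

(* Integrating one coordinate at a time turns the m-th indicator into the
   m-th side length. *)
Lemma box_cover_volume (p : 'I_d -> R) (e : R) (a b : nat -> 'I_d -> R) : 0 < e ->
  (forall k j, a k j <= b k j) ->
  [set t : 'I_d -> R | forall j, p j <= t j <= p j + e] `<=`
    \bigcup_k [set t : 'I_d -> R | forall j, a k j <= t j <= b k j] ->
  ((e ^+ d)%:E <= \sum_(0 <= k <oo) (\prod_(j < d) (b k j - a k j))%:E)%E.
Proof.
move=> e0 ab cov.
(* Coordinates below m are already integrated, the others are still evaluated at t. For m = 0 the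
   claim says that t is covered; for m = d it is the volume inequality. *)
pose wt m k (t : 'I_d -> R) (j : 'I_d) : R :=
  if (j < m)%N then b k j - a k j else \1_`[a k j, b k j] (t j).
have wt0 m k t j : 0 <= wt m k t j.
  by rewrite /wt; case: ifP => _; rewrite ?subr_ge0.
suff H m : (m <= d)%N -> forall t : 'I_d -> R, (forall j, p j <= t j <= p j + e) ->
    ((e ^+ m)%:E <= \sum_(0 <= k <oo) (\prod_(j < d) wt m k t j)%:E)%E.
  have := H d (leqnn d) p; under eq_eseriesr do under eq_bigr do rewrite /wt ltn_ord.
  by apply => j; rewrite lexx lerDl ltW.
elim: m => [_ t ht|m IH md t ht].
  have [k _ hk] := cov t ht.
  apply: le_trans (@nneseries_lim_ge R _ xpredT 0 k.+1 _); last first.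
    by move=> k' _ _; rewrite lee_fin prodr_ge0.
  rewrite big_nat_recr //= [X in (_ <= _ + X)%E](_ : _ = 1%:E); last first.
    congr EFin; rewrite big1 // => j _; rewrite /wt ltn0 indicE mem_set //=.
    by rewrite in_itv /=; exact: hk.
  rewrite expr0 leeDr // sume_ge0 // => i _; rewrite lee_fin prodr_ge0 //.
pose j0 := Ordinal md; pose D : set (measurableTypeR R) := `[p j0, p j0 + e]%classic.
have mD : measurable D by exact: measurable_itv.
pose w k := \prod_(j < d | j != j0) wt m k t j.
have w0 k : 0 <= w k by rewrite prodr_ge0.
have wE k x : \prod_(j < d) wt m k (upd t j0 x) j = w k * \1_`[a k j0, b k j0] x.
  rewrite (bigD1 j0) //= mulrC; congr (_ * _); last by rewrite /wt ltnn /upd eqxx.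
  by apply: eq_bigr => j /negPf jj; rewrite /wt /upd jj.
have wE' k : \prod_(j < d) wt m.+1 k t j = w k * (b k j0 - a k j0).
  rewrite (bigD1 j0) //= mulrC; congr (_ * _); last by rewrite /wt /= ltnS leqnn.
  apply: eq_bigr => j jj; rewrite /wt ltnS leq_eqVlt.
  by have -> : (j == m :> nat) = false by apply/negbTE; apply: contra jj => /eqP jm; apply/eqP/val_inj.
pose g k (x : measurableTypeR R) : \bar R := (w k * \1_`[a k j0, b k j0] x)%:E.
have g0 k x : (0 <= g k x)%E by rewrite lee_fin mulr_ge0.
have mg k : measurable_fun D (g k).
  apply/measurable_EFinP; apply: measurable_funM => //.
have IHx x : D x -> ((e ^+ m)%:E <= \sum_(0 <= k <oo) g k x)%E.
  rewrite /D /= in_itv /= => hx; have := IH (ltnW md) (upd t j0 x).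
  under eq_eseriesr do rewrite wE.
  by apply => j; rewrite /upd; case: eqP => [->|_]; [exact: hx|exact: ht].
have : (\int[lebesgue_measure]_(x in D) (cst (e ^+ m)%:E x) <=
    \int[lebesgue_measure]_(x in D) (\sum_(0 <= k <oo) g k x))%E.
  apply: ge0_le_integral => //.
  - by move=> x _; rewrite lee_fin exprn_ge0 // ltW.
  - have := @ge0_emeasurable_sum _ _ R D g xpredT (fun k x _ _ => g0 k x) (fun k _ => mg k).
    by apply: eq_measurable_fun => x _; apply: eq_eseriesl.
have muD : lebesgue_measure D = e%:E.
  rewrite (lebesgue_measure_itv `[p j0, p j0 + e]%R) /= lte_fin ltrDl e0.
  by rewrite -EFinB addrAC subrr add0r.
have intD : (\int[lebesgue_measure]_(x in D) (cst (e ^+ m)%:E x) = (e ^+ m.+1)%:E)%E.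
  apply: etrans (integral_cst lebesgue_measure mD (e ^+ m)%:E) _.
  by rewrite exprSr EFinM; congr (_ * _)%E; exact: muD.
rewrite intD integral_nneseries //.
move/le_trans; apply; apply: lee_nneseries => [k _ _|k _].
  by apply: integral_ge0.
rewrite /g; under eq_integral do rewrite EFinM.
rewrite ge0_integralZl_EFin //; last by apply/measurable_EFinP.
rewrite integral_indic // wE' EFinM lee_wpmul2l ?lee_fin //.
apply: (@le_trans _ _ (lebesgue_measure `[a k j0, b k j0]%classic)).
  by apply: le_measure; rewrite ?inE //; exact: measurableI.
rewrite lebesgue_measure_itv /= lte_fin; case: ifP => _; first by rewrite -EFinB.
by rewrite lee_fin subr_ge0.
Qed.

Lemma box_not_null (p : 'I_d -> R) (e : R) (A : set ('I_d -> R)) : 0 < e ->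
  [set t : 'I_d -> R | forall j, p j <= t j <= p j + e] `<=` A -> ~ lebesgue_null A.
Proof.
move=> e0 pA nA; have ed : 0 < e ^+ d / 2 by rewrite divr_gt0 ?exprn_gt0.
have [a [b [ab cov vol]]] := nA _ ed.
have := le_trans (box_cover_volume e0 ab (subset_trans pA cov)) vol.
rewrite lee_fin; lra.
Qed.

Lemma normc_cosin_sub (x y : R) :
  normc ((cos x +i* sin x) - (cos y +i* sin y)) ^+ 2 = 2 - 2 * cos (x - y).
Proof.
rewrite /= sqr_sqrtr ?addr_ge0 ?sqr_ge0 // cosB.
have := cos2Dsin2 x; have := cos2Dsin2 y; lra.
Qed.

Lemma cosin_continuous (e : R) : 0 < e -> exists2 dl : R, 0 < dl & forall x y,
  `|x - y| < dl -> normc ((cos x +i* sin x) - (cos y +i* sin y)) < e.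
Proof.
move=> e0; have := @continuous_cos R 0 => /cvgrPdist_lt /(_ (e ^+ 2 / 2)).
case=> [|dl dl0 hdl]; first by rewrite divr_gt0 ?exprn_gt0.
exists dl => // x y xy; rewrite -(@ltr_pXn2r _ 2) ?nnegrE ?normc_ge0 ?(ltW e0) //.
rewrite normc_cosin_sub; have := hdl (x - y).
rewrite /ball /= sub0r normrN cos0 => /(_ xy).
have := ler_norm (1 - cos (x - y)); lra.
Qed.

Lemma torus_pointP (z : point) : (forall j, normc (z 0 j) = 1) ->
  exists2 t : 'I_d -> R, (forall j, 0 <= t j <= 2 * pi) & torus_point t = z.
Proof.
move=> z1.
have ex j : exists t : R, 0 <= t <= 2 * pi /\ cos t +i* sin t = z 0 j.
  have := z1 j; case: (z 0 j) => a b /= /(congr1 (fun x => x ^+ 2)).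
  rewrite sqr_sqrtr ?addr_ge0 ?sqr_ge0 // expr1n => ab.
  have a1 : -1 <= a <= 1 by apply/andP; split; nra.
  have h0 := acos_ge0 a1; have h1 := acos_lepi a1.
  have ca : cos (acos a) = a by rewrite acosK // in_itv.
  have sa : sin (acos a) = `|b| by rewrite sin_acos // -sqrtr_sqr; congr Num.sqrt; lra.
  have [b0|b0] := leP 0 b.
    by exists (acos a); split; [apply/andP; split; lra|rewrite ca sa ger0_norm].
  exists (2 * pi - acos a); split; first by apply/andP; split; lra.
  rewrite -(cosN (_ - _)) opprB -[sin _]opprK -sinN opprB.
  have -> : acos a - 2 * pi = - (- acos a + pi *+ 2) by rewrite -mulr_natl; ring.
  rewrite cosN sinN (cosD2pi _) (sinD2pi _) cosN sinN ca sa opprK.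
  by rewrite ltr0_norm // opprK.
have [t ht] := choice ex; exists t => [j|]; first by case: (ht j).
by apply/rowP => j; rewrite mxE; case: (ht j).
Qed.

Lemma torus_point_norm (t : 'I_d -> R) j : normc (torus_point t 0 j) = 1.
Proof. by rewrite mxE /= cos2Dsin2 sqrtr1. Qed.

(** If a lower semicontinuous g exceeds y at one point, it does so on a box of angles around it, and
    such a box is not null. *)
Lemma torus_ae_everywhere (g : point -> R) (y : R) :
  (forall z : point, (forall j, normc (z 0 j) = 1) -> forall e : R, 0 < e ->
     exists2 dl : R, 0 < dl & forall w : point, (forall j, normc (w 0 j) = 1) ->
       (forall j, normc (w 0 j - z 0 j) < dl) -> g z < g w + e) ->
  torus_ae (fun z => g z <= y) -> forall z : point, (forall j, normc (z 0 j) = 1) -> g z <= y.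
Proof.
move=> gc ae z z1; rewrite leNgt; apply/negP => gz.
have gz0 : 0 < g z - y by lra.
have [dl dl0 hdl] := gc z z1 _ gz0.
have [dt dt0 hdt] := cosin_continuous dl0.
have [t ht tz] := torus_pointP z1.
have pi0 := pi_gt0 R.
pose e := Num.min (dt / 2) pi.
have e0 : 0 < e by rewrite /e lt_min pi0 andbT; lra.
have et : e <= dt / 2 by rewrite /e ge_min lexx.
have epi : e <= pi by rewrite /e ge_min lexx orbT.
(* The box extends to the right of small angles and to the left of large ones, so that it stays
   within [0, 2 pi]. *)
pose p j := if t j <= pi then t j else t j - e.
apply: (@box_not_null p e _ e0 _ ae) => t' ht'.
have tt j : `|t' j - t j| < dt /\ 0 <= t' j <= 2 * pi.
  have /andP[h1 h2] := ht j; have := ht' j; rewrite /p.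
  case: (leP (t j) pi) => h3 /andP[h4 h5].
    by rewrite ger0_norm; [split; [lra|apply/andP; split; lra]|lra].
  by rewrite ler0_norm; [split; [lra|apply/andP; split; lra]|lra].
split=> [j|]; first by case: (tt j).
apply/negP; rewrite -ltNge.
have := hdl (torus_point t') (torus_point_norm t') _.
have /[swap] /[apply] : forall j, normc (torus_point t' 0 j - z 0 j) < dl.
  by move=> j; rewrite -tz !mxE; apply: hdt; case: (tt j).
lra.
Qed.

Lemma torus_ae_all (P : point -> Prop) : (0 < d)%N ->
  (forall z : point, (forall j, normc (z 0 j) = 1) -> P z) -> torus_ae P.
Proof.
(* The exceptional set is empty, but the cover still consists of infinitely many boxes. Degenerate
   ones have volume 0 because d > 0; for d = 0 the empty product would be 1. *)
move=> d0 hP e e0; exists (fun _ _ => 0), (fun _ _ => 0); split=> //.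
  by move=> t [_ []]; apply: hP; exact: torus_point_norm.
rewrite eseries0 ?lee_fin ?ltW // => k _ _.
by rewrite (bigD1 (Ordinal d0)) //= subrr mul0r.
Qed.

Lemma torus_ae_sub (P Q : point -> Prop) : (forall z, P z -> Q z) ->
  torus_ae P -> torus_ae Q.
Proof.
move=> PQ hP e /hP[a [b [ab cov vol]]]; exists a, b; split=> // t [t01 nQ].
by apply: cov; split=> // /PQ.
Qed.

End NullSets.

(** * Boundary values and mean squares on tori near the unit torus *)

Section TorusValues.
Variables (R : realType) (d : nat).
Local Notation C := R[i].
Local Notation normc := (@Normc.normc R).
Local Notation point := 'rV[R[i]^o]_d.
Implicit Types (c : multinom d -> C).

(** The difference removes the term b = 0 of the binomial expansion, and every other term contains
    at least one factor h, hence a factor q. *)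
Lemma normc_monoB_le (z h : 'I_d -> C) (r e q : R) (a : multinom d) :
  0 <= r -> 0 <= e -> 0 <= q <= 1 -> (forall j, normc (z j) <= r) ->
  (forall j, normc (h j) <= q * e) ->
  normc (mono (fun j => z j + h j) a - mono z a) <= q * (r + e) ^+ mdeg a.
Proof.
move=> r0 e0 /andP[q0 q1] zr hq; have aK := @box_mdeg d (mdeg a).+1 a (ltnSn _).
have bK : @mnm0 d \in box d (mdeg a).+1 by apply: box_mdeg; rewrite mdeg0.
rewrite (monoD _ _ aK) (big_fsetD1 (@mnm0 d)) //= subm0.
have -> : mono h (@mnm0 d) = 1 by rewrite /mono big1 // => j _; rewrite mnm0E.
have -> : binm a (@mnm0 d) = 1%N by rewrite /binm big1 // => j _; rewrite mnm0E bin0.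
rewrite mul1r mulr1 addrAC subrr add0r; apply: (le_trans (le_normc_sum _ _ _)).
have E := sum_binm_expr r e aK; rewrite (big_fsetD1 (@mnm0 d)) //= in E.
rewrite -E mulrDr.
apply: ler_wpDl; first by rewrite !mulr_ge0 ?ler0n ?exprn_ge0.
rewrite mulr_sumr big_seq [leRHS]big_seq; apply: ler_sum => b.
rewrite !inE => /andP[b0 _]; rewrite !Normc.normcM.
rewrite -(rmorph_nat (real_complex R)) normcR ger0_norm ?ler0n //.
rewrite [leRHS]mulrCA -mulrA -mulrA ler_wpM2l ?ler0n //.
apply: ler_pM; rewrite ?normc_ge0 //; first exact: normc_mono_le.
apply: le_trans (normc_mono_le _ hq) _; rewrite exprMn ler_wpM2r ?exprn_ge0 //.
have : (0 < mdeg b)%N by rewrite lt0n mdeg_eq0.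
by case: (mdeg b) => // k _; rewrite exprS ler_piMr // exprn_ile1.
Qed.

Lemma expands_lipschitz (f : ('I_d -> C) -> C) c s r : expands f c s -> 0 <= r < s ->
  exists L e : R, [/\ 0 <= L, 0 < e & forall z h q, 0 <= q <= 1 ->
    (forall j, normc (z j) <= r) -> (forall j, normc (h j) <= q * e) ->
    normc (f (fun j => z j + h j) - f z) <= L * q].
Proof.
move=> [[M cM] cf] /andP[r0 rs]; have s0 : 0 < s by exact: le_lt_trans rs.
pose e := (s - r) / 2; have e0 : 0 < e by rewrite /e; lra.
have res : r + e < s by rewrite /e; lra.
have re0 : 0 <= r + e < s by rewrite addr_ge0 // ltW.
exists (M * ((1 - (r + e) / s)^-1) ^+ d), e; split=> //.
  by rewrite mulr_ge0 ?(decay_ge0 s0 cM) // exprn_ge0 // invr_ge0 subr_ge0 ler_pdivrMr // mul1r ltW.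
move=> z h q q01 zr hq; have /andP[q0 q1] := q01.
have hz := cf z (fun j => le_lt_trans (zr j) rs).
have hzh : has_sum (fun a => c a * mono (fun j => z j + h j) a) (f (fun j => z j + h j)).
  apply: cf => j; apply: le_lt_trans (le_normcD _ _) _.
  have := zr j; have := hq j; have : q * e <= e by rewrite ler_piMl // ltW.
  lra.
apply: (has_sum_le (has_sumB hzh hz)) => B.
rewrite mulrC; apply: (@le_trans _ _ (q * \sum_(a <- enum_fset B) normc (c a) * (r + e) ^+ mdeg a)).
  rewrite mulr_sumr; apply: ler_sum => a _; rewrite -mulrBr Normc.normcM mulrCA.
  by rewrite ler_wpM2l ?normc_ge0 //; apply: normc_monoB_le => //; exact: ltW.
by rewrite ler_wpM2l //; exact: decay_sum.
Qed.

Variables (Phi : point -> C) (c : multinom d -> C) (s : R).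
Hypothesis Phi_c : expands (fun w => Phi (\row_j w j)) c s.

Lemma dilate_continuous (u : R) : 0 < u < s -> forall z : point,
  (forall j, normc (z 0 j) = 1) -> forall e : R, 0 < e ->
  exists2 dl : R, 0 < dl & forall w : point, (forall j, normc (w 0 j) = 1) ->
    (forall j, normc (w 0 j - z 0 j) < dl) ->
    `|normc (Phi (dilate u z)) - normc (Phi (dilate u w))| < e.
Proof.
move=> /andP[u0 us] z z1 e e0.
have us' : 0 <= u < s by rewrite ltW.
have [L [h [L0 h0 lip]]] := expands_lipschitz Phi_c us'.
pose q := Num.min 1 (e / (L + 1) / 2).
have L1 : 0 < L + 1 by lra.
have q0 : 0 < q by rewrite /q lt_min ltr01 /= !divr_gt0.
have q1 : q <= 1 by rewrite /q ge_min lexx.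
have q2 : L * q < e.
  have : q <= e / (L + 1) / 2 by rewrite /q ge_min lexx orbT.
  move=> /(ler_wpM2l L0) /le_lt_trans; apply.
  have k0 : 0 < e / (L + 1) by rewrite divr_gt0.
  have ke : e / (L + 1) * (L + 1) = e by rewrite divfK // gt_eqF.
  by rewrite -[ltRHS]ke; nra.
exists (q * h / u); first by rewrite divr_gt0 // mulr_gt0.
move=> w w1 wz; apply: le_lt_trans q2.
have -> : dilate u w = \row_j (u%:C * z 0 j + u%:C * (w 0 j - z 0 j)).
  by apply/rowP => j; rewrite !mxE; ring.
have q01 : 0 <= q <= 1 by rewrite ltW.
have := lip (fun j => u%:C * z 0 j) (fun j => u%:C * (w 0 j - z 0 j)) q q01.
move=> /(_ _ _) /=; set x := Phi _; set y := Phi _ => hxy.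
have {}hxy : normc (x - y) <= L * q.
  apply: hxy => j; rewrite Normc.normcM normcR gtr0_norm ?z1 ?mulr1 //.
  by rewrite mulrC -ler_pdivlMr // ltW.
rewrite ler_norml; apply/andP; split.
  have := le_normcD y (x - y); rewrite addrC subrK; lra.
have := le_normcD x (y - x); rewrite addrC subrK [normc (y - x)]normc_sub; lra.
Qed.

Lemma torus_ae_dilate_le (u y : R) : 0 < u < s ->
  torus_ae (fun z => normc (Phi (dilate u z)) <= y) ->
  forall z : point, (forall j, normc (z 0 j) = 1) -> normc (Phi (dilate u z)) <= y.
Proof.
move=> us; apply: torus_ae_everywhere => z z1 e e0.
have [dl dl0 hdl] := dilate_continuous us z1 e0.
exists dl => // w w1 wz; have := hdl w w1 wz; rewrite ltr_norml => /andP[]; lra.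
Qed.

Lemma dilate1 (z : point) : dilate 1 z = z.
Proof. by apply/rowP => j; rewrite mxE mul1r. Qed.

Lemma torus_norm1 : 1 < s -> torus_ae (fun z => normc (Phi z) = 1) ->
  forall z : point, (forall j, normc (z 0 j) = 1) -> normc (Phi z) = 1.
Proof.
move=> s1 ae z z1; have us : (0 : R) < 1 < s by rewrite ltr01.
apply/eqP; rewrite eq_le; apply/andP; split.
  rewrite -[z]dilate1; apply: torus_ae_dilate_le us _ z z1.
  by apply: torus_ae_sub ae => w; rewrite dilate1 => ->.
(* The lower bound is the same principle applied to -|Phi|. *)
rewrite -lerN2; apply: (@torus_ae_everywhere _ _ (fun z => - normc (Phi z))) z z1 => [z z1 e e0|].
  have [dl dl0 hdl] := dilate_continuous us z1 e0.
  exists dl => // w w1 wz; have := hdl w w1 wz; rewrite !dilate1 ltr_norml => /andP[]; lra.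
by apply: torus_ae_sub ae => w ->.
Qed.

Lemma le_torus_Linfty (u : R) : 0 < u < s -> forall z : point,
  (forall j, normc (z 0 j) = 1) ->
  ((normc (Phi (dilate u z)))%:E <= torus_Linfty (fun z => Phi (dilate u z)))%E.
Proof.
move=> us z z1; apply: le_ereal_inf_tmp => -[y| |] /= ae; rewrite ?leey //.
  by rewrite lee_fin; exact: (torus_ae_dilate_le us ae).
(* The remaining bound is -oo; it would give the bound -1 for a modulus. *)
have := @torus_ae_dilate_le u (-1) us _ z z1.
have : torus_ae (fun z => normc (Phi (dilate u z)) <= -1) by apply: torus_ae_sub ae.
move=> h1 h2; exfalso; have := h2 h1; have := normc_ge0 (Phi (dilate u z)); lra.
Qed.

Lemma torus_Linfty_le (u y : R) : (0 < d)%N ->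
  (forall z : point, (forall j, normc (z 0 j) = 1) -> normc (Phi (dilate u z)) <= y) ->
  (torus_Linfty (fun z => Phi (dilate u z)) <= y%:E)%E.
Proof.
by move=> d0 hy; apply: ereal_inf_lbound; apply: torus_ae_all => // z /hy; rewrite lee_fin.
Qed.

Lemma dilate_sqr_sum_le (u S : R) (B : {fset multinom d}) : 0 < u < s ->
  (forall z : point, (forall j, normc (z 0 j) = 1) -> normc (Phi (dilate u z)) <= S) ->
  \sum_(a <- enum_fset B) (normc (c a) * u ^+ mdeg a) ^+ 2 <= S ^+ 2.
Proof.
move=> us hS; have [[M cM] cf] := Phi_c; have /andP[u0 us'] := us.
apply: (decay_sqr_sum_le B us cM) => z v zu hv.
have -> : v = Phi (\row_j z j).
  by apply: has_sum_unique hv (cf _ _) => j; rewrite zu.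
have -> : \row_j z j = dilate u (\row_j (u^-1%:C * z j)).
  by apply/rowP => j; rewrite !mxE mulrA -rmorphM divff ?mul1r // gt_eqF.
by apply: hS => j; rewrite mxE Normc.normcM zu normcR gtr0_norm ?invr_gt0 // mulVf // gt_eqF.
Qed.

End TorusValues.

(** * The radial index *)

Section RadialIndex.
Variables (R : realType) (d : nat).
Local Notation C := R[i].
Local Notation normc := (@Normc.normc R).
Local Notation point := 'rV[R[i]^o]_d.
Variables (Phi : point -> C) (c : multinom d -> C) (s : R).
Hypothesis s_gt1 : 1 < s.
Hypothesis Phi_c : expands (fun w => Phi (\row_j w j)) c s.

Lemma radial_index_lt (L r : R) : (radial_index Phi < L%:E)%E -> 1 < r -> r <= s ->
  exists2 u, 1 < u < r & forall z : point, (forall j, normc (z 0 j) = 1) ->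
    normc (Phi (dilate u z)) <= u `^ L.
Proof.
move=> /ereal_inf_lt[_ [V V1 <-] VL] r1 rs.
have [u [uV [u1 ur]]] : exists u : R, V u /\ 1 < u /\ u < r.
  apply: (@filter_ex _ (at_right (1 : R))); near=> u; split; [|split].
  - by near: u.
  - by near: u; exact: nbhs_right_gt.
  - by near: u; exact: nbhs_right_lt.
exists u; first by rewrite u1.
move=> z z1; have us : 0 < u < s by rewrite (lt_trans ltr01) //= (lt_le_trans ur).
have lu : 0 < ln u by rewrite ln_gt0.
have fu := le_lt_trans (ereal_sup_ubound (imageP _ uV)) VL.
have [->|n0] := eqVneq (normc (Phi (dilate u z))) 0; first exact: powR_ge0.
have {}n0 : 0 < normc (Phi (dilate u z)) by rewrite lt_def n0 normc_ge0.
have hL := le_torus_Linfty Phi_c us z1.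
have : ((ln (normc (Phi (dilate u z))))%:E <= lne (torus_Linfty (fun z => Phi (dilate u z))))%E.
  rewrite -lne_EFin // lee_lne // in_itv /= ?lee_fin ?(ltW n0) ?leey // (le_trans _ hL) //.
  by rewrite lee_fin ltW.
have lui : (0 <= ((ln u)%:E)^-1)%E by rewrite inver gt_eqF // lee_fin invr_ge0 ltW.
move=> /(lee_wpmul2r lui) /le_lt_trans /(_ fu).
rewrite inver gt_eqF // -EFinM lte_fin ltr_pdivrMr // => h.
rewrite -[leLHS]lnK ?posrE // /powR gt_eqF ?(lt_trans ltr01) // ler_expR ltW //.
Unshelve. all: by end_near.
Qed.

Hypothesis Phi_torus : forall z : point, (forall j, normc (z 0 j) = 1) -> normc (Phi z) = 1.

Lemma coef_sqr_sum_le (B : {fset multinom d}) :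
  \sum_(a <- enum_fset B) normc (c a) ^+ 2 <= 1.
Proof.
have us : (0 : R) < 1 < s by rewrite ltr01.
have := dilate_sqr_sum_le Phi_c (S := 1) B us.
rewrite expr1n; under eq_bigr do rewrite expr1n mulr1.
by apply=> z z1; rewrite dilate1 Phi_torus.
Qed.

Lemma coef_le1 a : normc (c a) <= 1.
Proof.
have := coef_sqr_sum_le (fset1 a); rewrite big_seq_fset1.
by rewrite expr_le1 // normc_ge0.
Qed.

(** As |Phi| = 1 on the torus, the Lipschitz bound gives |Phi(u z)| <= 1 + (L/e)(u - 1), whose
    logarithm is at most (L/e)(u - 1). The factor 2 comes from u - 1 <= u ln u <= 2 ln u for u <=
    2. *)
Lemma radial_index_le : (0 < d)%N -> exists K : R, (radial_index Phi <= K%:E)%E.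
Proof.
move=> d0; have r1 : (0 : R) <= 1 < s by rewrite ler01.
have [L [e [L0 e0 lip]]] := expands_lipschitz Phi_c r1.
exists (2 * (L / e)); apply: ereal_inf_le.
pose V := [set u : R | 1 < u /\ u < 1 + Num.min 1 e].
have e1 : 0 < Num.min 1 e by rewrite lt_min ltr01.
exists (ereal_sup ((fun u : R => lne (torus_Linfty (fun z => Phi (dilate u z))) / (ln u)%:E)%E @` V)).
  exists V => //; near=> u; split; first by near: u; exact: nbhs_right_gt.
  by near: u; apply: nbhs_right_lt; rewrite ltrDl.
apply: ge_ereal_sup => _ [u [u1 u2] <-].
have u0 : 0 < u by lra.
have lu : 0 < ln u by rewrite ln_gt0.
have me : Num.min 1 e <= e by rewrite ge_min lexx orbT.
have m1 : Num.min 1 e <= 1 by rewrite ge_min lexx.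
have ue : u - 1 <= e by lra.
have ul : u <= 2 by lra.
have hS (z : point) : (forall j, normc (z 0 j) = 1) -> normc (Phi (dilate u z)) <= 1 + L / e * (u - 1).
  move=> z1; have q01 : 0 <= (u - 1) / e <= 1.
    by rewrite divr_ge0 ?(ltW e0) ?subr_ge0 ?(ltW u1) //= ler_pdivrMr // mul1r.
  have := lip (fun j => z 0 j) (fun j => (u - 1)%:C * z 0 j) _ q01.
  have -> : \row_j (z 0 j + (u - 1)%:C * z 0 j) = dilate u z.
    by apply/rowP => j; rewrite !mxE rmorphB rmorph1 mulrBl mul1r addrC subrK.
  have -> : (\row_j z 0 j : point) = z by apply/rowP => j; rewrite mxE.
  move=> h; have {}h : normc (Phi (dilate u z) - Phi z) <= L * ((u - 1) / e).
    apply: h => j; first by rewrite z1.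
    by rewrite Normc.normcM normcR z1 mulr1 ger0_norm ?subr_ge0 ?(ltW u1) // divfK // gt_eqF.
  have := le_normcD (Phi z) (Phi (dilate u z) - Phi z); rewrite addrC subrK (Phi_torus z1) => h2.
  apply: (le_trans h2); rewrite lerD2l; apply: (le_trans h); by rewrite mulrA mulrAC.
have hL := torus_Linfty_le d0 hS.
have k0 : 0 <= L / e * (u - 1) by rewrite mulr_ge0 ?divr_ge0 ?subr_ge0 // ltW.
have S0 : 0 < 1 + L / e * (u - 1) by rewrite ltr_pwDl.
have X : (lne (torus_Linfty (fun z => Phi (dilate u z))) <= (L / e * (u - 1))%:E)%E.
  have [h|h] := leP (torus_Linfty (fun z => Phi (dilate u z))) 0%E.
    by rewrite (le0_lneNy h) leNye.
  apply: (@le_trans _ _ (lne (1 + L / e * (u - 1))%:E)).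
    by rewrite lee_lne // in_itv /= ?lee_fin ?leey ?(ltW h) ?(ltW S0).
  by rewrite lne_EFin // lee_fin le_ln1Dx // (lt_le_trans _ k0) // ltrN10.
have lui : (0 <= ((ln u)%:E)^-1)%E by rewrite inver gt_eqF // lee_fin invr_ge0 ltW.
apply: (le_trans (lee_wpmul2r lui X)).
rewrite inver gt_eqF // -EFinM lee_fin ler_pdivrMr // [2 * _]mulrC -[leRHS]mulrA ler_wpM2l ?divr_ge0 ?(ltW e0) //.
have : ln u^-1 <= u^-1 - 1.
  have -> : u^-1 = 1 + (u^-1 - 1) by ring.
  by rewrite [leRHS]addrAC subrr add0r; apply: le_ln1Dx; rewrite ltrBrDr addNr invr_gt0.
rewrite lnV ?posrE // => h; have : (u - 1) <= u * ln u.
  have : u * (1 - u^-1) <= u * ln u by rewrite ler_pM2l //; lra.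
  by rewrite mulrBr mulr1 divff ?gt_eqF.
move=> /le_trans; apply; rewrite ler_pM2r //.
Unshelve. all: by end_near.
Qed.

(** With S the essential supremum at radius u and k = |c_a|^2, Parseval gives S^2 >= 1 + k (u^2 -
    1), because the total mass is 1 and the index a gains at least a factor u^2. Logarithms give ln
    S >= (k/4) ln u for u < 2. *)
Lemma radial_index_gt0 a : a != @mnm0 d -> c a != 0 -> (0 < radial_index Phi)%E.
Proof.
move=> a0 ca; pose k := normc (c a) ^+ 2.
have k0 : 0 < k by rewrite exprn_gt0 // normc_gt0.
have k1 : k <= 1 by rewrite expr_le1 ?normc_ge0 ?coef_le1.
pose K := k / 4; have K0 : 0 < K by rewrite divr_gt0.
apply: (@lt_le_trans _ _ K%:E); first by rewrite lte_fin.
apply: le_ereal_inf_tmp => _ [V V1 <-].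
have s2 : 1 < Num.min s 2 by rewrite lt_min s_gt1 ltr1n.
have [u [uV [u1 ur]]] : exists u : R, V u /\ 1 < u /\ u < Num.min s 2.
  apply: (@filter_ex _ (at_right (1 : R))); near=> u; split; [|split].
  - by near: u.
  - by near: u; exact: nbhs_right_gt.
  - by near: u; exact: nbhs_right_lt.
have u0 : 0 < u by lra.
have lu : 0 < ln u by rewrite ln_gt0.
have us : 0 < u < s by move: ur; rewrite lt_min => /andP[-> _]; rewrite u0.
have u2 : u < 2 by move: ur; rewrite lt_min => /andP[_].
have lui : (0 <= ((ln u)%:E)^-1)%E by rewrite inver gt_eqF // lee_fin invr_ge0 ltW.
apply: le_trans (ereal_sup_ubound (imageP _ uV)).
have -> : K%:E = ((K * ln u)%:E * ((ln u)%:E)^-1)%E.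
  by rewrite inver gt_eqF // -EFinM mulfK // gt_eqF.
apply: lee_wpmul2r => //.
have one1 : forall j, normc ((\row_j 1 : point) 0 j) = 1 by move=> j; rewrite mxE Normc.normc1.
have hL := le_torus_Linfty Phi_c us.
case E : (torus_Linfty (fun z => Phi (dilate u z))) (hL) => [S| |] {}hL; last first.
- by have := hL _ one1.
- by rewrite leey.
have hS (z : point) : (forall j, normc (z 0 j) = 1) -> normc (Phi (dilate u z)) <= S.
  by move=> /hL; rewrite lee_fin.
have S0 : 0 <= S := le_trans (normc_ge0 _) (hS _ one1).
have SS : 1 + k * (u ^+ 2 - 1) <= S ^+ 2.
  (* Mass 1 is only approached by finite sets of indices, so e is given up first and removed
     afterwards. *)
  have H (e : R) : 0 < e -> 1 - e + k * (u ^+ 2 - 1) <= S ^+ 2.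
    move=> e0; have [M' cM] := Phi_c.1.
    have r1 : (0 : R) <= 1 < s by rewrite ler01.
    have [T hT] : exists T : {fset multinom d}, 1 - e <= \sum_(b <- enum_fset T) normc (c b) ^+ 2.
      have [Kb hKb] := decay_trunc_small r1 cM (divr_gt0 e0 (ltr0n _ 2)).
      exists (box d Kb); have [e2|e2] := ltP 1 (e / 2).
        apply: (@le_trans _ _ 0); first lra.
        by apply: sumr_ge0 => b _; exact: sqr_ge0.
      apply: (@le_trans _ _ ((1 - e / 2) ^+ 2)); first by nra.
      apply: sum_sqr_coef_ge; rewrite ?fset_uniq ?subr_ge0 // => z z1.
      have hz : has_sum (fun b => c b * mono z b) (Phi (\row_j z j)).
        by apply: Phi_c.2 => j; rewrite z1.
      have := hKb Kb z _ (leqnn _) _ hz; set y := \sum_(_ <- _) _ => hy.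
      have {}hy : normc (Phi (\row_j z j) - y) <= e / 2 by apply: hy => j; rewrite z1.
      have := le_normcD y (Phi (\row_j z j) - y); rewrite addrC subrK Phi_torus => [|j]; last by rewrite mxE.
      lra.
    apply: le_trans (dilate_sqr_sum_le Phi_c (fsetU (fset1 a) T) us hS).
    have aT : a \in fsetU (fset1 a) T by rewrite !inE eqxx.
    apply: (@le_trans _ _ (\sum_(b <- enum_fset (fsetU (fset1 a) T)) normc (c b) ^+ 2 + k * (u ^+ 2 - 1))).
      by rewrite lerD2r (le_trans hT) // sum_fsubset_le ?fsubsetUr // => b; exact: sqr_ge0.
    rewrite (big_fsetD1 a) //= [leRHS](big_fsetD1 a) //= -/k addrAC.
    have h1 b : 1 <= u ^+ mdeg b by rewrite exprn_ege1 // ltW.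
    apply: lerD.
      rewrite exprMn -/k -[X in X + _]mulr1 -mulrDr addrC subrK ler_pM2l //.
      apply: lerXn2r; rewrite ?nnegrE ?(ltW u0) ?(le_trans ler01) //.
      have : (0 < mdeg a)%N by rewrite lt0n mdeg_eq0.
      by case: (mdeg a) => // n _; rewrite exprS ler_peMr ?(ltW u0) // exprn_ege1 // ltW.
    apply: ler_sum => b _; rewrite exprMn ler_peMr ?sqr_ge0 // exprn_ege1 //.
  apply/ler_addgt0Pr => e e0; have := H e e0; lra.
have u21 : 1 <= u ^+ 2 by rewrite exprn_ege1 // ltW.
have t0 : 0 <= k * (u ^+ 2 - 1) by rewrite mulr_ge0 ?(ltW k0) // subr_ge0.
have S1 : 0 < S.
  rewrite lt_def S0 andbT; apply/eqP => S00; move: SS; rewrite S00 expr0n /=; lra.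
rewrite lne_EFin // lee_fin.
have x0 : 0 < 1 + k * (u ^+ 2 - 1) by lra.
have h2 : ln (1 + k * (u ^+ 2 - 1)) <= 2 * ln S.
  by rewrite mulr_natl -lnXn // ler_ln ?posrE ?exprn_gt0.
set t := k * (u ^+ 2 - 1) in SS x0 t0 h2 *.
have h3 : t / (1 + t) <= ln (1 + t).
  have : ln (1 + t)^-1 <= (1 + t)^-1 - 1.
    rewrite -{1}[(1 + t)^-1](subrK 1) addrC; apply: le_ln1Dx.
    by rewrite ltrBrDr addNr invr_gt0.
  rewrite lnV ?posrE // => h; have : t / (1 + t) = 1 - (1 + t)^-1 by field; lra.
  lra.
have t4 : 1 + t <= 4 by rewrite /t; nra.
have h4 : ln u <= u - 1.
  have -> : u = 1 + (u - 1) by ring.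
  by rewrite [leRHS]addrAC subrr add0r; apply: le_ln1Dx; lra.
have h5 : k * (u - 1) / 2 <= t / (1 + t).
  rewrite ler_pdivlMr // mulrAC ler_pdivrMr //.
  have : k * (u - 1) * (1 + t) <= k * (u - 1) * 4.
    by rewrite ler_wpM2l // mulr_ge0 ?(ltW k0) // subr_ge0 ltW.
  rewrite /t; nra.
rewrite /K; nra.
Unshelve. all: by end_near.
Qed.

End RadialIndex.

(** * Sup norms of polynomials *)

Section MaximumPrinciple.
Variable R : realType.
Local Notation C := R[i].
Local Notation normc := (@Normc.normc R).

Lemma poly_coef_le (p : {poly C}) (r S : R) k : 0 <= r ->
  (forall t, normc t = r -> normc p.[t] <= S) -> normc p`_k * r ^+ k <= S.
Proof.
move=> r0 pS.
have S0 : 0 <= S.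
  by apply: le_trans (normc_ge0 _) (pS r%:C _); rewrite normcR ger0_norm.
have [kp|pk] := ltnP k (size p); last by rewrite nth_default // Normc.normc0 mul0r.
pose K := size p; pose a : multinom 1 := mnm_of (n := 1) [ffun _ => Ordinal kp].
have a0 : a ord0 = k by rewrite mnm_ofE ffunE.
have aK : a \in box 1 K by rewrite in_box; apply/forallP => j; rewrite mnm_ofE ffunE.
have := @coef_le_sup R 1 (enum_fset (box 1 K)) (fun b => p`_(b ord0)) r S a (fset_uniq _) r0 aK.
rewrite a0 mdegE big_ord1 a0; apply => z zr.
rewrite sum_box; have -> : \sum_(f : {ffun 'I_1 -> 'I_K}) p`_((mnm_of f) ord0) * mono z (mnm_of f)
    = p.[z ord0].
  rewrite horner_coef -[RHS](big_ord1 *%R (fun i => \sum_(k < K) p`_k * z i ^+ k)) bigA_distr_bigA /=.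
  by apply: eq_bigr => f _; rewrite big_ord1 /mono big_ord1 !mnm_ofE.
exact: pS.
Qed.

(* Applied to powers P^k, the coefficient bound gives
   |P(z)|^k <= B^k (1 - r)^-n, and k -> oo removes the factor (1 - r)^-n. *)
Lemma polydisc_max n (P : mpoly n C) (B : R) :
  (forall z, (forall j, normc (z j) = 1) -> normc (meval z P) <= B) ->
  forall z, (forall j, normc (z j) < 1) -> normc (meval z P) <= B.
Proof.
move=> PB z z1.
have B0 : 0 <= B.
  by apply: le_trans (normc_ge0 _) (PB (fun=> 1) _) => j; rewrite Normc.normc1.
have [r /andP[r0 r1] zr] : exists2 r, 0 <= r < 1 & forall j, normc (z j) <= r.
  exists (\big[Num.max/0]_j normc (z j)) => [|j]; last exact: (@le_bigmax_cond _ _ _ _ j xpredT).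
  by rewrite bigmax_ge_id /=; apply: bigmax_lt.
pose K := ((1 - r)^-1) ^+ n.
have Pk k : normc (meval z P) ^+ k <= B ^+ k * K.
  rewrite -normcX -rmorphXn /= mevalE.
  have coefk a : a \in msupp (P ^+ k) -> normc (mcoeff a (P ^+ k)) <= B ^+ k.
    move=> aP; have := @coef_le_sup R n (msupp (P ^+ k)) (fun a => mcoeff a (P ^+ k)) 1 (B ^+ k) a
      (msupp_uniq _) ler01 aP.
    rewrite expr1n mulr1; apply => w w1; rewrite -[\sum_(_ <- _) _]mevalE rmorphXn /= normcX.
    by rewrite lerXn2r ?nnegrE ?normc_ge0 // PB.
  apply: (le_trans (le_normc_sum _ _ _)).
  apply: (@le_trans _ _ (\sum_(a <- msupp (P ^+ k)) B ^+ k * r ^+ mdeg a)).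
    rewrite big_seq [leRHS]big_seq; apply: ler_sum => a aP; rewrite Normc.normcM.
    by rewrite ler_pM ?normc_ge0 ?coefk //; exact: normc_mono_le.
  rewrite -mulr_sumr ler_wpM2l ?exprn_ge0 //.
  have -> : \sum_(a <- msupp (P ^+ k)) r ^+ mdeg a =
      \sum_(a <- enum_fset [fset a in msupp (P ^+ k)]%fset) r ^+ mdeg a.
    by apply: perm_big; apply: uniq_perm; rewrite ?msupp_uniq ?fset_uniq // => a; rewrite inE.
  by apply: sum_expr_mdeg_le; rewrite r0.
rewrite leNgt; apply/negP => lt; set x := normc _ in Pk lt.
have x0 : 0 < x by exact: le_lt_trans lt.
have q01 : 0 <= B / x < 1 by rewrite divr_ge0 ?(ltW x0) //= ltr_pdivrMr // mul1r.
(* For some power k2, K B^k2 is at most half of x^k2, which contradicts [Pk]. *)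
have [k2 hk2] := geom_small K q01 (divr_gt0 ltr01 (ltr0n R 2)).
have := hk2 k2 (leqnn _); rewrite expr_div_n mulrA ler_pdivrMr ?exprn_gt0 // => h.
have := Pk k2; rewrite mulrC => h'.
have : 0 < x ^+ k2 by rewrite exprn_gt0.
lra.
Qed.

Lemma polydisc_norm_le n (P : mpoly n C) (B : R) :
  (forall z, (forall j, normc (z j) = 1) -> normc (meval z P) <= B) ->
  polydisc_norm P <= B.
Proof.
move=> PB; apply: ge_sup.
  exists (normc (mpoly_eval P 0)), 0 => // j; rewrite mxE Normc.normc0; exact: ltr01.
by move=> _ [z z1 <-]; exact: (polydisc_max PB).
Qed.

(** Cauchy's estimate on the torus of radius 1/2, which lies inside the open polydisc. The bound [B]
    makes the set of values bounded, so that [sup] is a genuine supremum. *)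
Lemma polydisc_norm_gt0 n (P : mpoly n C) (B : R) : P != 0 ->
  (forall z, (forall j, normc (z j) = 1) -> normc (meval z P) <= B) ->
  0 < polydisc_norm P.
Proof.
move=> P0 PB.
have [a aP] : exists a, a \in msupp P.
  have : msupp P != [::] by rewrite msupp_eq0.
  by case: (msupp P) => // a l _; exists a; rewrite mem_head.
have r0 : (0 : R) <= 2^-1 by lra.
have := @coef_le_sup R n (msupp P) (fun a => mcoeff a P) 2^-1 (polydisc_norm P) a
      (msupp_uniq _) r0 aP.
have a0 : 0 < normc (mcoeff a P) by rewrite normc_gt0 -mcoeff_msupp.
move=> h; apply: lt_le_trans (h _); first by rewrite mulr_gt0 // exprn_gt0 //; lra.
move=> z zr; rewrite -[\sum_(_ <- _) _]mevalE.
apply: sup_upper_bound; last first.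
  exists (\row_j z j); first by move=> j; rewrite mxE zr; lra.
  by congr normc; apply: meval_eq => j; rewrite mxE.
split.
  exists (normc (mpoly_eval P 0)), 0 => // j; rewrite mxE Normc.normc0; exact: ltr01.
by exists B => _ [w w1 <-]; exact: (polydisc_max PB).
Qed.

End MaximumPrinciple.

Lemma big_option (A : Type) (idx : A) (op : Monoid.com_law idx) (T : finType)
    (F : option T -> A) :
  \big[op/idx]_(x : option T) F x = op (F None) (\big[op/idx]_(y : T) F (Some y)).
Proof.
rewrite (bigD1 None) //=; congr (op _ _).
rewrite (reindex_omap Some id) => [|[]//].
by apply: eq_bigl => y; rewrite /= eqxx.
Qed.

(** * The homogenized tensor power *)

Section TensorPower.
Variables (R : realType) (d N m : nat) (c : multinom d -> R[i]).
Local Notation C := R[i].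
Local Notation normc := (@Normc.normc R).
Local Notation T := (bmultinom d m.+1).
Local Notation V := (option ('I_N * 'I_d)).
Local Notation n := #|{: V}|.
Implicit Types (a : {ffun 'I_N -> T}).

Definition tdeg a : nat := \sum_i mdeg (bmnm (a i)).

(** Variable [Some (i, j)] is the j-th variable of the i-th factor and [None] is the homogenizing
    one. Its exponent is a truncated difference, so the total degree is m only when
    [tdeg a <= m]. *)
Definition tmnm a : multinom n := Multinom [tuple
  (if enum_val k is Some p then bmnm (a p.1) p.2 else m - tdeg a)%N | k < n].

(* The last variable homogenizes the truncated N-fold tensor power of c. *)
Definition tpoly : mpoly n C :=
  \sum_(a | (tdeg a <= m)%N) (\prod_i c (bmnm (a i))) *: mpolyX C (tmnm a).

Lemma tmnmE a (v : V) : tmnm a (enum_rank v) =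
  (if v is Some p then bmnm (a p.1) p.2 else m - tdeg a)%N.
Proof. by rewrite mnmE enum_rankK. Qed.

Lemma tmnm_inj : injective tmnm.
Proof.
move=> a b /mnmP ab; apply/ffunP => i; apply: val_inj; apply/mnmP => j.
by have := ab (enum_rank (Some (i, j))); rewrite !tmnmE.
Qed.

Lemma big_tvar (A : Type) (idx : A) (op : Monoid.com_law idx) (F : 'I_n -> A) :
  \big[op/idx]_k F k = op (F (enum_rank None))
    (\big[op/idx]_i \big[op/idx]_j F (enum_rank (Some (i, j)))).
Proof.
transitivity (\big[op/idx]_(v : V) F (enum_rank v)).
  rewrite [RHS](reindex (enum_val (A := {: V}))) /=; last first.
    by apply: onW_bij; exact: enum_val_bij.
  by apply: eq_bigr => k _; rewrite enum_valK.
rewrite big_option pair_big /=; congr (op _ _).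
by apply: eq_bigr => -[i j] _.
Qed.

Lemma mdeg_tmnm a : (tdeg a <= m)%N -> mdeg (tmnm a) = m.
Proof.
move=> am; rewrite mdegE big_tvar /= tmnmE.
under eq_bigr => i _ do under eq_bigr => j _ do rewrite tmnmE /=.
by under eq_bigr do rewrite -mdegE; rewrite subnK.
Qed.

Lemma mcoeff_tpoly a : (tdeg a <= m)%N ->
  mcoeff (tmnm a) tpoly = \prod_i c (bmnm (a i)).
Proof.
move=> am; rewrite raddf_sum /= (bigD1 a) //= mcoeffZ mcoeffX eqxx mulr1.
rewrite [X in _ + X]big1 ?addr0 // => b /andP[_ ba]; rewrite mcoeffZ mcoeffX.
by rewrite (inj_eq tmnm_inj) (negPf ba) mulr0.
Qed.

Lemma tpoly_homog : tpoly \is ishomog1 m mdeg.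
Proof.
apply/dhomogP => b /msupp_sum_le /flattenP[l /mapP[a]].
rewrite mem_filter => /andP[am _] -> /msuppZ_le; rewrite msuppX inE => /eqP ->.
exact: mdeg_tmnm.
Qed.

Lemma meval_tpoly (z : 'I_n -> C) : meval z tpoly =
  \sum_(a | (tdeg a <= m)%N)
    (\prod_i (c (bmnm (a i)) * mono (fun j => z (enum_rank (Some (i, j)))) (bmnm (a i)))) *
    z (enum_rank None) ^+ (m - tdeg a).
Proof.
rewrite raddf_sum /=; apply: eq_bigr => a _.
rewrite mevalZ mevalX big_tvar /= tmnmE big_split /= -mulrA; congr (_ * _).
rewrite mulrC; congr (_ * _); apply: eq_bigr => i _; apply: eq_bigr => j _.
by rewrite tmnmE.
Qed.

Definition trunc (z : 'I_d -> C) : C := \sum_(x : T) c (bmnm x) * mono z (bmnm x).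

(** The tensor power along the complex line through z: its k-th coefficient is the homogeneous part
    of degree k, so univariate Cauchy estimates bound these parts. *)
Definition tensor_poly (z : 'I_N -> 'I_d -> C) : {poly C} :=
  \prod_i \sum_(x : T) (c (bmnm x) * mono (z i) (bmnm x)) *: 'X^(mdeg (bmnm x)).

Lemma tensor_polyE z : tensor_poly z =
  \sum_(a : {ffun 'I_N -> T})
    (\prod_i (c (bmnm (a i)) * mono (z i) (bmnm (a i)))) *: 'X^(tdeg a).
Proof.
rewrite /tensor_poly bigA_distr_bigA /=; apply: eq_bigr => a _.
rewrite scaler_prod; congr (_ *: _).
by rewrite /tdeg -prodrXr.
Qed.

Lemma mono_scale (t : C) (z : 'I_d -> C) (b : multinom d) :
  mono (fun j => t * z j) b = t ^+ mdeg b * mono z b.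
Proof.
rewrite -prod_expr_mdeg -big_split /=; apply: eq_bigr => j _.
by rewrite exprMn.
Qed.

Lemma horner_tensor_poly z t : (tensor_poly z).[t] = \prod_i trunc (fun j => t * z i j).
Proof.
rewrite /tensor_poly horner_prod; apply: eq_bigr => i _.
rewrite horner_sum; apply: eq_bigr => x _.
by rewrite hornerZ hornerXn mono_scale mulrAC mulrA.
Qed.

Lemma coef_tensor_poly z k : (tensor_poly z)`_k =
  \sum_(a | tdeg a == k) \prod_i (c (bmnm (a i)) * mono (z i) (bmnm (a i))).
Proof.
rewrite tensor_polyE coef_sum [RHS]big_mkcond /=; apply: eq_bigr => a _.
by rewrite coefZ coefXn eq_sym; case: eqP => _; rewrite ?mulr1 ?mulr0.
Qed.

Variables (u E1 E2 : R).
Hypothesis u1 : 1 < u.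
Hypothesis trunc1 : forall z, (forall j, normc (z j) = 1) -> normc (trunc z) <= E1.
Hypothesis truncu : forall z, (forall j, normc (z j) = u) -> normc (trunc z) <= E2.

Lemma geom_tail_le (x : R) D k : 0 <= x < 1 ->
  \sum_(k <= i < D) x ^+ i <= x ^+ k / (1 - x).
Proof.
move=> /andP[x0 x1]; have x1' : 0 < 1 - x by rewrite subr_gt0.
rewrite ler_pdivlMr //; have [kD|Dk] := leqP k D; last first.
  by rewrite big_geq ?mul0r ?exprn_ge0 // ltnW.
have : (\sum_(k <= i < D) x ^+ i) * (1 - x) = x ^+ k - x ^+ D.
  rewrite mulr_suml; under eq_bigr do rewrite mulrBr mulr1 -exprSr.
  rewrite (eq_bigr (fun i => - (x ^+ i.+1 - x ^+ i))) => [|i _]; last by rewrite opprB.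
  by rewrite sumrN telescope_sumr // opprB.
by move=> ->; rewrite lerBlDr lerDl exprn_ge0.
Qed.

(** With w the homogenizing variable, the value is w^m times the sum of F_k w^-k over k <= m. The
    full sum is F(1/w), a value of the tensor power on the unit torus. The tail is bounded by
    Cauchy's estimates at radius u, and the powers u^-k with k > m sum to at most u^-m / (u - 1). *)
Lemma tpoly_torus (z : 'I_n -> C) : (forall k, normc (z k) = 1) ->
  normc (meval z tpoly) <= E1 ^+ N + E2 ^+ N * u^-1 ^+ m / (u - 1).
Proof.
move=> z1; pose Z i j := z (enum_rank (Some (i, j))).
pose w := z (enum_rank None); have w1 : normc w = 1 by exact: z1.
have w0 : w != 0 by rewrite -normc_gt0 w1.
pose F := tensor_poly Z.
have nb (t : C) (E : R) : (forall i, normc (trunc (fun j => t * Z i j)) <= E) ->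
    normc F.[t] <= E ^+ N.
  move=> hE; rewrite horner_tensor_poly normc_prod -[N in E ^+ N]card_ord -prodr_const.
  by apply: ler_prod => i _; rewrite normc_ge0 hE.
have F1 : normc F.[w^-1] <= E1 ^+ N.
  apply: nb => i; apply: trunc1 => j.
  by rewrite Normc.normcM Normc.normcV w1 invr1 mul1r z1.
have u0 : 0 < u by exact: lt_trans ltr01 u1.
have Fk k : normc F`_k <= E2 ^+ N * u^-1 ^+ k.
  rewrite exprVn ler_pdivlMr ?exprn_gt0 //; apply: poly_coef_le; first exact: ltW.
  by move=> t tu; apply: nb => i; apply: truncu => j; rewrite Normc.normcM tu z1 mulr1.
have S0 : 0 <= E2 ^+ N.
  by have := Fk 0%N; rewrite expr0 mulr1; apply: le_trans; exact: normc_ge0.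
pose D := (N * m).+1.
have tD a : (tdeg a < D)%N.
  rewrite ltnS /tdeg -[N in (N * m)%N]card_ord -sum_nat_const leq_sum // => i _.
  by have := bmdeg (a i); rewrite ltnS.
have sumF (P : pred nat) : \sum_(k < D | P k) F`_k * w^-1 ^+ k =
    \sum_(a | P (tdeg a)) (\prod_i (c (bmnm (a i)) * mono (Z i) (bmnm (a i)))) * w^-1 ^+ tdeg a.
  under eq_bigr do rewrite /F coef_tensor_poly mulr_suml.
  rewrite (exchange_big_dep (fun a => P (tdeg a))) /=; last by move=> k a Pk /eqP ->.
  apply: eq_bigr => a Pa; rewrite (big_pred1 (Ordinal (tD a))) //.
  by move=> k; rewrite /= andbC -val_eqE /= eq_sym; case: eqP => // ->.
have ev : meval z tpoly = w ^+ m * \sum_(k < D | (k <= m)%N) F`_k * w^-1 ^+ k.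
  rewrite (sumF (fun k => k <= m)%N) meval_tpoly mulr_sumr; apply: eq_bigr => a am.
  rewrite -/w mulrCA; congr (_ * _).
  by rewrite exprVn expfB_cond ?(negPf w0) //= ?add0n.
have Fw : F.[w^-1] = \sum_(k < D) F`_k * w^-1 ^+ k.
  rewrite (sumF xpredT) /F tensor_polyE horner_sum; apply: eq_bigr => a _.
  by rewrite hornerZ hornerXn.
rewrite ev Normc.normcM normcX w1 expr1n mul1r.
have -> : \sum_(k < D | (k <= m)%N) F`_k * w^-1 ^+ k =
    F.[w^-1] - \sum_(k < D | ~~ (k <= m)%N) F`_k * w^-1 ^+ k.
  by rewrite Fw [X in _ = X - _](bigID (fun k : 'I_D => (k <= m)%N)) /= addrK.
apply: (le_trans (le_normcB _ _)); apply: lerD => //.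
apply: (le_trans (le_normc_sum _ _ _)).
have x01 : 0 <= u^-1 < 1 by rewrite invr_ge0 (ltW u0) invf_lt1.
apply: (@le_trans _ _ (E2 ^+ N * \sum_(m.+1 <= k < D) u^-1 ^+ k)).
  rewrite mulr_sumr big_geq_mkord /=.
  rewrite [leRHS](eq_bigl (fun k : 'I_D => ~~ (k <= m)%N)) => [|k]; last by rewrite -ltnNge.
  by apply: ler_sum => k _; rewrite Normc.normcM normcX Normc.normcV w1 invr1 expr1n mulr1.
rewrite -mulrA ler_wpM2l //; apply: (le_trans (geom_tail_le _ _ x01)).
rewrite exprSr -mulrA ler_wpM2l ?exprn_ge0 ?invr_ge0 ?(ltW u0) //.
have -> : 1 - u^-1 = (u - 1) / u by rewrite mulrBl mul1r divff ?gt_eqF.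
by rewrite invf_div mulKf ?gt_eqF.
Qed.

Lemma bh_const_ge (Y : R) : (0 < m)%N -> 0 < Y ->
  Y <= \sum_(a | (tdeg a <= m)%N) (\prod_i normc (c (bmnm (a i)))) `^ (bh_exponent R m) ->
  ((Y `^ (bh_exponent R m)^-1 / (E1 ^+ N + E2 ^+ N * u^-1 ^+ m / (u - 1)))%:E
    <= bh_const R m)%E.
Proof.
move=> m0 Y0 YS; set B := E1 ^+ N + _; set q := bh_exponent R m.
have q0 : 0 < q by rewrite /q /bh_exponent divr_gt0 // ltr0n // muln_gt0.
have sumP : \sum_(a | (tdeg a <= m)%N) (\prod_i normc (c (bmnm (a i)))) `^ q <=
    \sum_(b <- msupp tpoly) normc (mcoeff b tpoly) `^ q.
  pose s := [seq tmnm a | a <- enum {ffun 'I_N -> T} & (tdeg a <= m)%N].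
  have us : uniq s.
    rewrite map_inj_uniq; last exact: tmnm_inj.
    by apply: filter_uniq; exact: enum_uniq.
  have -> : \sum_(a | (tdeg a <= m)%N) (\prod_i normc (c (bmnm (a i)))) `^ q =
      \sum_(b <- s) normc (mcoeff b tpoly) `^ q.
    rewrite big_map big_filter big_enum_cond /=; apply: eq_bigr => a am.
    by rewrite mcoeff_tpoly // normc_prod.
  (* Tuples with a vanishing coefficient are outside the support; they contribute 0 because q is not
     0. *)
  rewrite (bigID (fun b => b \in msupp tpoly)) /= [X in _ + X]big1 ?addr0; last first.
    by move=> b bP; rewrite memN_msupp_eq0 // Normc.normc0 powR0 // gt_eqF.
  rewrite -big_filter.
  have us2 : uniq [seq i <- s | i \in msupp tpoly] by rewrite filter_uniq.
  rewrite [leRHS](bigID (fun b => b \in s)) /= -[in leRHS]big_filter.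
  rewrite (perm_big [seq i <- msupp tpoly | i \in s]) /=; last first.
    apply: uniq_perm => //; first by rewrite filter_uniq // msupp_uniq.
    by move=> b; rewrite !mem_filter andbC.
  by rewrite lerDl sumr_ge0 // => b _; exact: powR_ge0.
have P0 : tpoly != 0.
  apply: contraTneq (lt_le_trans Y0 (le_trans YS sumP)) => ->.
  by rewrite msupp0 big_nil ltxx.
have nB : 0 < polydisc_norm tpoly <= B.
  by rewrite (polydisc_norm_gt0 P0 tpoly_torus) (polydisc_norm_le tpoly_torus).
have /andP[n0 nB'] := nB.
apply: (@le_trans _ _ (coef_norm q tpoly / polydisc_norm tpoly)%:E).
  rewrite lee_fin; apply: ler_pM; rewrite ?powR_ge0 ?invr_ge0 ?(le_trans (ltW n0)) //.
    rewrite /coef_norm ge0_ler_powR ?invr_ge0 ?(ltW q0) ?nnegrE ?(ltW Y0) //.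
      by rewrite (le_trans (ltW Y0)) // (le_trans YS).
    exact: le_trans sumP.
  by rewrite lef_pV2 ?posrE // (lt_le_trans n0).
apply: (@le_trans _ _ (bh_const_dim R m n)).
  apply: ereal_sup_ubound; exists tpoly => //; split; first exact: tpoly_homog.
  exact/eqP.
by apply: ereal_sup_ubound; exists n => //=; rewrite card_option.
Qed.

End TensorPower.

(** * The tensor power as a product distribution *)

Lemma ln_prod (R : realType) (I : finType) (F : I -> R) :
  (forall i, 0 < F i) -> ln (\prod_i F i) = \sum_i ln (F i).
Proof.
move=> F0; suff [] : 0 < \prod_i F i /\ ln (\prod_i F i) = \sum_i ln (F i) by [].
elim/big_rec2: _ => [|i y1 y2 _ [y20 <-]]; first by rewrite ltr01 ln1.
by rewrite mulr_gt0 // lnM // posrE.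
Qed.

Section EntropySum.
Variables (R : realType) (d N m : nat) (c : multinom d -> R[i]).
Local Notation C := R[i].
Local Notation normc := (@Normc.normc R).
Local Notation T := (bmultinom d m.+1).
Local Notation A := {ffun 'I_N -> T}.

Local Notation wt x := (normc (c (bmnm x)) ^+ 2).

Definition surprisal (b : multinom d) : R := - ln (normc (c b) ^+ 2).

Hypothesis c1 : forall b, normc (c b) <= 1.

Lemma surprisal_ge0 b : 0 <= surprisal b.
Proof. by rewrite oppr_ge0 ln_le0 // expr_le1 ?normc_ge0. Qed.

Lemma sum_tensor_weight : \sum_(a : A) \prod_i wt (a i) = (\sum_(x : T) wt x) ^+ N.
Proof.
by rewrite -(bigA_distr_bigA (fun (_ : 'I_N) (x : T) => wt x)) prodr_const card_ord.
Qed.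

(** The mean of a function of one coordinate. The truncated weights have mass possibly below 1, so
    the other N - 1 coordinates leave a power of that mass. *)
Lemma sum_tensor_marginal (g : T -> R) (i0 : 'I_N) :
  \sum_(a : A) (\prod_i wt (a i)) * g (a i0) =
  (\sum_(x : T) wt x * g x) * (\sum_(x : T) wt x) ^+ N.-1.
Proof.
transitivity (\prod_(i : 'I_N) \sum_(x : T) wt x * (if i == i0 then g x else 1)).
  rewrite bigA_distr_bigA /=; apply: eq_bigr => a _.
  rewrite [RHS]big_split /=; congr (_ * _).
  by rewrite (bigD1 i0) //= eqxx big1 ?mulr1 // => i /negPf ->.
rewrite (bigD1 i0) //= eqxx; congr (_ * _).
under eq_bigr => i /negPf -> do under eq_bigr do rewrite mulr1.
rewrite prodr_const; congr (_ ^+ _).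
by rewrite -[in RHS](card_ord N) (cardD1 i0 'I_N) /=; apply: eq_card => i; rewrite !inE andbT.
Qed.

Variables (u V : R).
Hypothesis u1 : 1 < u.
Hypothesis uV : \sum_(x : T) (normc (c (bmnm x)) * u ^+ mdeg (bmnm x)) ^+ 2 <= V ^+ 2.
Hypothesis s1 : \sum_(x : T) wt x <= 1.

(** Markov's inequality for u^(2 tdeg): it exceeds u^(2m) on the tail, and its mean is a product of
    N factors, each at most V^2. *)
Lemma sum_tensor_tail : \sum_(a : A | ~~ (tdeg a <= m)%N) \prod_i wt (a i) <=
  (V ^+ N * u^-1 ^+ m) ^+ 2.
Proof.
have u0 : 0 < u by exact: lt_trans ltr01 u1.
rewrite exprMn -!exprM exprVn ler_pdivlMr ?exprn_gt0 //.
apply: (@le_trans _ _ (\sum_(a : A) \prod_i (normc (c (bmnm (a i))) * u ^+ mdeg (bmnm (a i))) ^+ 2)).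
  rewrite mulr_suml big_mkcond /=; apply: ler_sum => a _; case: leqP => am.
    by apply: prodr_ge0 => i _; exact: sqr_ge0.
  under [leRHS]eq_bigr do rewrite exprMn -exprM.
  rewrite [leRHS]big_split /= -expr_sum ler_wpM2l //.
    by apply: prodr_ge0 => i _; exact: sqr_ge0.
  by apply: ler_weXn2l; [exact: ltW|rewrite -big_distrl /= leq_mul2r ltnW].
rewrite -(bigA_distr_bigA (fun (_ : 'I_N) (x : T) =>
  (normc (c (bmnm x)) * u ^+ mdeg (bmnm x)) ^+ 2)) prodr_const card_ord.
rewrite [(N * 2)%N]mulnC exprM lerXn2r ?nnegrE ?sqr_ge0 // sumr_ge0 // => x _; exact: sqr_ge0.
Qed.

(* The tangent line of exp at x0 replaces Jensen's inequality. *)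
Lemma powR_tangent (w x0 : R) : (0 < m)%N -> 0 <= w ->
  expR x0 * (w ^+ 2 * (1 + - ln (w ^+ 2) / m.+1%:R - x0)) <= w `^ (bh_exponent R m).
Proof.
move=> m0; rewrite le_eqVlt => /orP[/eqP <-|w0].
  by rewrite expr0n /= mul0r mulr0 powR_ge0.
(* The exponent equals 2 - 2/(m+1). *)
have -> : w `^ (bh_exponent R m) = w ^+ 2 * expR (- ln (w ^+ 2) / m.+1%:R).
  rewrite /powR gt_eqF // -[X in X * expR _]lnK ?posrE ?exprn_gt0 // -expRD.
  congr expR.
  rewrite lnXn // /bh_exponent natrM -natr1 mulr2n; field.
  by rewrite addrC natr1 pnatr_eq0.
rewrite mulrCA ler_wpM2l ?sqr_ge0 //; set x := _ / _.
have -> : expR x = expR x0 * expR (x - x0) by rewrite -expRD addrC subrK.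
by rewrite ler_wpM2l ?expR_ge0 // -addrA expR_ge1Dx.
Qed.

(** Summing the tangent inequality over the tuples of degree at most m needs their mass, which is at
    least s^N - t, and their mean surprisal. Only coordinates in [B] are credited. Over all tuples
    this credit has mean N h s^(N-1), and since it never exceeds N K, the tuples of larger degree
    take away at most N K t. *)
Lemma entropy_sum_ge (B : {fset multinom d}) (x0 : R) : (0 < m)%N ->
  (forall b, b \in B -> (mdeg b < m.+1)%N) ->
  let s := \sum_(x : T) wt x in let t := (V ^+ N * u^-1 ^+ m) ^+ 2 in
  let h := \sum_(b <- enum_fset B) normc (c b) ^+ 2 * surprisal b in
  let K := \sum_(b <- enum_fset B) surprisal b in
  is_true (expR x0 * (1 - x0 - `|1 - x0| * (1 - s ^+ N + t) +
             N%:R / m.+1%:R * (h * s ^+ N.-1 - K * t)) <=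
  \sum_(a : A | (tdeg a <= m)%N) (\prod_i normc (c (bmnm (a i)))) `^ (bh_exponent R m)).
Proof.
move=> m0 Bm s t h K.
pose p (a : A) := \prod_i wt (a i); pose g (x : T) := if bmnm x \in B then surprisal (bmnm x) else 0.
have p0 a : 0 <= p a by apply: prodr_ge0 => i _; exact: sqr_ge0.
have g0 x : 0 <= g x by rewrite /g; case: ifP => // _; exact: surprisal_ge0.
have gK x : g x <= K.
  rewrite /g; case: ifP => [xB|_]; last by apply: sumr_ge0 => b _; exact: surprisal_ge0.
  rewrite /K (big_fsetD1 (bmnm x)) //= lerDl sumr_ge0 // => b _; exact: surprisal_ge0.
have tail := sum_tensor_tail; rewrite -/t in tail.
have pm : \sum_(a : A | (tdeg a <= m)%N) p a = s ^+ N - \sum_(a : A | ~~ (tdeg a <= m)%N) p a.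
  rewrite -sum_tensor_weight.
  by rewrite [X in _ = X - _](bigID (fun a : A => (tdeg a <= m)%N)) /= addrK.
have s0 : 0 <= s by apply: sumr_ge0 => x _; exact: sqr_ge0.
have sumgh : \sum_(x : T) wt x * g x = h.
  rewrite /h; pose l := [seq bmnm x | x <- enum {: T} & bmnm x \in B].
  transitivity (\sum_(b <- l) normc (c b) ^+ 2 * surprisal b).
    rewrite big_map big_filter big_enum_cond /= [RHS]big_mkcond /=.
    by apply: eq_bigr => x _; rewrite /g; case: ifP; rewrite ?mulr0.
  apply: perm_big; apply: uniq_perm.
  - by rewrite map_inj_uniq; [apply: filter_uniq; exact: enum_uniq|exact: val_inj].
  - exact: fset_uniq.
  move=> b; apply/mapP/idP => [[x]|bB]; first by rewrite mem_filter => /andP[xB _] ->.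
  by exists (BMultinom (Bm b bB)) => //; rewrite mem_filter mem_enum andbT.
pose G (a : A) := \sum_i g (a i).
have G0 a : 0 <= G a by apply: sumr_ge0.
have GK a : G a <= N%:R * K.
  rewrite -[N in N%:R]card_ord mulr_natl -sumr_const; apply: ler_sum => i _; exact: gK.
have sumG : \sum_(a : A) p a * G a = N%:R * (h * s ^+ N.-1).
  rewrite /G; under eq_bigr do rewrite mulr_sumr.
  rewrite exchange_big /=; under eq_bigr do rewrite sum_tensor_marginal sumgh.
  by rewrite sumr_const card_ord mulr_natl.
have EG : N%:R * (h * s ^+ N.-1 - K * t) <= \sum_(a : A | (tdeg a <= m)%N) p a * G a.
  rewrite mulrBr -sumG (bigID (fun a : A => (tdeg a <= m)%N)) /= -addrA gerDl subr_le0.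
  rewrite mulrA; apply: le_trans (ler_wpM2l _ tail); last first.
    by rewrite mulr_ge0 ?ler0n // sumr_ge0 // => b _; exact: surprisal_ge0.
  rewrite mulr_sumr; apply: ler_sum => a _; rewrite mulrC ler_wpM2r ?GK //; exact: p0.
apply: (@le_trans _ _ (\sum_(a : A | (tdeg a <= m)%N)
    expR x0 * (p a * (1 + G a / m.+1%:R - x0)))); last first.
  apply: ler_sum => a _; set w := \prod_i _.
  have w0 : 0 <= w by apply: prodr_ge0 => i _; exact: normc_ge0.
  apply: le_trans (powR_tangent x0 m0 w0); rewrite ler_wpM2l ?expR_ge0 //.
  have -> : p a = w ^+ 2 by rewrite /p /w prodrXl.
  (* For w = 0 the convention ln 0 = 0 breaks the additivity of -ln over the factors, but there the
     weight w^2 vanishes. *)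
  have [->|wn0] := eqVneq w 0; first by rewrite expr0n /= !mul0r.
  rewrite ler_wpM2l ?sqr_ge0 // lerD2r lerD2l ler_wpM2r ?invr_ge0 ?ler0n //.
  have cn0 i : normc (c (bmnm (a i))) != 0.
    by apply: contraNneq wn0 => e; rewrite /w (bigD1 i) //= e mul0r.
  have -> : - ln (w ^+ 2) = \sum_i surprisal (bmnm (a i)).
    rewrite sumrN; congr (- _); rewrite /w -prodrXl ln_prod // => i.
    by rewrite exprn_gt0 // lt_def cn0 normc_ge0.
  by apply: ler_sum => i _; rewrite /g; case: ifP => // _; exact: surprisal_ge0.
rewrite -mulr_sumr ler_wpM2l ?expR_ge0 //.
have -> : \sum_(a : A | (tdeg a <= m)%N) p a * (1 + G a / m.+1%:R - x0) =
    (\sum_(a : A | (tdeg a <= m)%N) p a) * (1 - x0) +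
    (\sum_(a : A | (tdeg a <= m)%N) p a * G a) / m.+1%:R.
  by rewrite !mulr_suml -big_split /=; apply: eq_bigr => a _; ring.
apply: lerD; last by rewrite mulrAC ler_wpM2r ?invr_ge0 ?ler0n.
rewrite pm; set y := \sum_(a : A | _) _ in tail *.
have y0 : 0 <= y by apply: sumr_ge0 => a _; exact: p0.
have sN : s ^+ N <= 1 by rewrite exprn_ile1.
have : (1 - x0) * (1 - (s ^+ N - y)) <= `|1 - x0| * (1 - s ^+ N + t).
  apply: (@le_trans _ _ (`|1 - x0| * (1 - (s ^+ N - y)))).
    by rewrite ler_wpM2r ?ler_norm //; lra.
  by rewrite ler_wpM2l //; lra.
lra.
Qed.

End EntropySum.

(** * The lower bound *)

Section LowerBound.
Variables (R : realType) (d : nat).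
Local Notation C := R[i].
Local Notation normc := (@Normc.normc R).
Local Notation point := 'rV[R[i]^o]_d.

Definition degset m : {fset multinom d} :=
  [fset b in [seq bmnm x | x <- enum {: bmultinom d m.+1}]]%fset.

Lemma in_degset m b : (b \in degset m) = (mdeg b < m.+1)%N.
Proof.
rewrite inE /=; apply/mapP/idP => [[x _ ->]|bm]; first exact: bmdeg.
by exists (BMultinom bm); rewrite ?mem_enum.
Qed.

Lemma sum_degset (W : zmodType) m (G : multinom d -> W) :
  \sum_(b <- enum_fset (degset m)) G b = \sum_(x : bmultinom d m.+1) G (bmnm x).
Proof.
rewrite -[RHS]big_enum -(big_map (@bmnm d m.+1) xpredT G) /=.
apply: perm_big; apply: uniq_perm; first exact: fset_uniq.
  by rewrite map_inj_uniq ?enum_uniq //; exact: val_inj.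
by move=> b; rewrite inE.
Qed.

Lemma bernoulli_ge (x : R) k : 0 <= x <= 1 -> 1 - k%:R * (1 - x) <= x ^+ k.
Proof.
move=> /andP[x0 x1]; elim: k => [|k IH]; first by rewrite mul0r subr0.
rewrite exprSr -natr1; apply: le_trans (ler_wpM2r x0 IH).
have : 0 <= k%:R * (1 - x) * (1 - x) by rewrite !mulr_ge0 ?ler0n // subr_ge0.
nra.
Qed.

(** Some k > 1 still satisfies k x < 1, and Bernoulli's inequality bounds m (k - 1) by k^m, so m x^m
    is at most (k x)^m / (k - 1). *)
Lemma mul_geom_small (A x e : R) : 0 < x < 1 -> 0 <= A -> 0 < e ->
  exists K, forall m, (K <= m)%N -> A * (m%:R * x ^+ m) <= e.
Proof.
move=> /andP[x0 x1] A0 e0; pose k := (1 + x^-1) / 2.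
have xi : 1 < x^-1 by rewrite invf_gt1.
have k1 : 1 < k by rewrite /k; lra.
have kx : k * x = (x + 1) / 2.
  by rewrite /k mulrAC mulrDl mul1r mulVf ?gt_eqF.
have r01 : 0 <= k * x < 1 by rewrite kx; apply/andP; split; lra.
have [K hK] := geom_small (A / (k - 1)) r01 e0.
exists K => m /hK; apply: le_trans; rewrite exprMn mulrA -mulrA [leRHS]mulrA.
rewrite mulrA ler_wpM2r ?exprn_ge0 ?(ltW x0) // -mulrA ler_wpM2l // mulrC.
rewrite ler_pdivlMr ?subr_gt0 //.
have : 1 + m%:R * (k - 1) <= k ^+ m.
  elim: (m) => [|j IH]; first by rewrite mul0r addr0.
  rewrite exprSr -natr1; apply: le_trans (ler_wpM2r _ IH); last lra.
  have : 0 <= j%:R * (k - 1) * (k - 1) by rewrite !mulr_ge0 ?ler0n // subr_ge0 ltW.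
  nra.
lra.
Qed.

Variables (Phi : point -> C) (c : multinom d -> C) (s : R).
Hypothesis s_gt1 : 1 < s.
Hypothesis Phi_c : expands (fun w => Phi (\row_j w j)) c s.
Hypothesis Phi_torus : forall z : point, (forall j, normc (z 0 j) = 1) -> normc (Phi z) = 1.

Lemma trunc_error (u : R) : 1 < u < s -> exists K x : R,
  [/\ 0 <= K, 0 < x < 1 & forall m z, (forall j, normc (z j) <= u) ->
    normc (Phi (\row_j z j) - trunc m c z) <= K * x ^+ m].
Proof.
move=> /andP[u1 us]; have [[M cM] cf] := Phi_c; pose t := (u + s) / 2.
have s0 : 0 < s by exact: lt_trans s_gt1.
have ut : 0 <= u < t by rewrite /t; apply/andP; split; lra.
have ts : t < s by rewrite /t; lra.
have t0 : 0 < t by rewrite /t; lra.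
have x01 : 0 < t / s < 1 by rewrite divr_gt0 //= ltr_pdivrMr // mul1r.
have K0 : 0 <= M * ((1 - u / t)^-1) ^+ d.
  rewrite mulr_ge0 ?(decay_ge0 s0 cM) // exprn_ge0 // invr_ge0 subr_ge0 ler_pdivrMr //.
  by rewrite mul1r; case/andP: ut => _ /ltW.
exists (M * ((1 - u / t)^-1) ^+ d), (t / s); split=> // m z zu.
have hz : has_sum (fun b => c b * mono z b) (Phi (\row_j z j)).
  by apply: cf => j; exact: le_lt_trans (zu j) us.
have := @decay_trunc _ _ c M s u t m.+1 z _ (degset m) ut ts cM zu _ hz.
rewrite sum_degset => h; apply: le_trans (h _) _ => [b|]; first by rewrite in_degset.
rewrite ler_wpM2l // exprS ler_piMl ?exprn_ge0 ?(ltW (divr_gt0 t0 s0)) //.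
by case/andP: x01 => _ /ltW.
Qed.

(* With N = floor(m / L2) factors, V = u^L1 gives V^N u^-m <= phi^m for
   phi = u^(L1/L2 - 1) < 1, while the truncation error er is O(x^m), x < 1. *)
Lemma bh_const_lower (L1 L2 y : R) (B : {fset multinom d}) :
  (radial_index Phi < L1%:E)%E -> 0 < L1 -> L1 < L2 ->
  y < (\sum_(b <- enum_fset B) normc (c b) ^+ 2 * surprisal c b) / L2 / 2 ->
  exists m0, forall m, (m0 <= m)%N -> ((expR y)%:E <= bh_const R m)%E.
Proof.
move=> rL L10 L12; set h := \sum_(_ <- _) _ => yh.
have c1 := coef_le1 s_gt1 Phi_c Phi_torus.
have L20 : 0 < L2 by exact: lt_trans L12.
(* Thus y = x0/2 - 2e. One e pays for the sup norm, at most exp(e); the other for having x0 - e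
   instead of x0 in the exponent, since (m+1)/(2m) <= 1. *)
pose x0 := h / L2; pose e := (x0 / 2 - y) / 2.
have e0 : 0 < e by rewrite /e /x0; lra.
have [u /andP[u1 us] uV] := radial_index_lt Phi_c rL s_gt1 (lexx s).
have u0 : 0 < u by exact: lt_trans ltr01 u1.
have lu : 0 < ln u by rewrite ln_gt0.
pose V := u `^ L1.
have VE : V = expR (L1 * ln u) by rewrite /V /powR gt_eqF.
have V1 : 1 <= V by rewrite VE -expR0 ler_expR mulr_ge0 // ltW.
have u1s : 1 < u < s by rewrite u1.
have [Ke [x [Ke0 x01 herr]]] := trunc_error u1s.
have /andP[xp x1] := x01.
pose phi := expR ((L1 / L2 - 1) * ln u).
have phi01 : 0 <= phi < 1.
  rewrite expR_ge0 /phi expR_lt1 pmulr_llt0 // subr_lt0 ltr_pdivrMr // mul1r //.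
pose K := \sum_(b <- enum_fset B) surprisal c b.
have sp0 b : 0 <= surprisal c b by exact: surprisal_ge0.
have K0 : 0 <= K by apply: sumr_ge0.
have h0 : 0 <= h by apply: sumr_ge0 => b _; rewrite mulr_ge0 ?sqr_ge0.
have x00 : 0 <= x0 by rewrite /x0 divr_ge0 // ltW.
(* The total coefficient of eta in the error: the lost mass 1 - S^N + t is at most 3 eta, N/(m+1)
   falls short of 1/L2 by at most (1/L2 + 1) eta, and the mean surprisal loses at most (2h + K)
   eta. *)
pose Q := 3 * `|1 - x0| + h * (L2^-1 + 1) + (2 * h + K) / L2.
have Li0 : 0 < L2^-1 by rewrite invr_gt0.
have Q0 : 0 <= Q.
  by rewrite /Q !addr_ge0 // mulr_ge0 ?addr_ge0 ?normr_ge0 ?mulr_ge0 // ltW.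
have d0 : 0 < 1 - expR (- e) by rewrite subr_gt0 expR_lt1 oppr_lt0.
pose eta := Num.min ((1 - expR (- e)) / (Q + 1)) (e / (1 + (u - 1)^-1)).
have um0 : 0 < u - 1 by rewrite subr_gt0.
have ui0 : 0 < 1 + (u - 1)^-1 by rewrite addr_gt0 // invr_gt0.
have Q1 : 0 < Q + 1 by exact: ltr_wpDl Q0 ltr01.
have eta0 : 0 < eta.
  by rewrite /eta lt_min; apply/andP; split; exact: divr_gt0.
have etaQ : eta * Q <= 1 - expR (- e).
  have : eta <= (1 - expR (- e)) / (Q + 1) by rewrite /eta ge_min lexx.
  rewrite ler_pdivlMr // mulrDr mulr1; lra.
have etae : eta + eta / (u - 1) <= e.
  have : eta <= e / (1 + (u - 1)^-1) by rewrite /eta ge_min lexx orbT.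
  by rewrite ler_pdivlMr // mulrDr mulr1.
have [m1 hm1] := mul_geom_small x01 (mulr_ge0 Ke0 (ltW Li0)) eta0.
have [m2 hm2] := geom_small 1 phi01 eta0.
pose m3 := Num.bound eta^-1.
pose m4 := \max_(b <- enum_fset B) mdeg b.
exists (maxn (maxn m1 m2) (maxn m3 m4)).+1 => m hm.
have m0 : (0 < m)%N by apply: leq_trans hm.
have {}hm1 := hm1 m (leq_trans (leq_trans (leq_trans (leq_maxl _ _) (leq_maxl _ _)) (leqnSn _)) hm).
have {}hm2 := hm2 m (leq_trans (leq_trans (leq_trans (leq_maxr _ _) (leq_maxl _ _)) (leqnSn _)) hm).
have hm3 : m.+1%:R^-1 <= eta.
  rewrite -[leRHS]invrK lef_pV2 ?posrE ?invr_gt0 ?ltr0n //.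
  apply: le_trans (ltW (archi_boundP _)) _; first by rewrite invr_ge0 ltW.
  rewrite ler_nat; apply: leq_trans (leqnSn _); apply: leq_trans hm; apply: leq_trans (leqnSn _).
  by apply: leq_trans (leq_maxr _ _); exact: leq_maxl.
have Bm b : b \in B -> (mdeg b < m.+1)%N.
  move=> bB; rewrite ltnS; apply: (@leq_trans m4).
    by rewrite /m4 (big_rem b) //= leq_maxl.
  apply: leq_trans hm; apply: leq_trans (leqnSn _).
  by apply: leq_trans (leq_maxr _ _); exact: leq_maxr.
rewrite mul1r in hm2.
pose N := Num.truncn (m%:R / L2); pose er := Ke * x ^+ m.
have mL0 : 0 <= m%:R / L2 by rewrite divr_ge0 ?ler0n // ltW.
have /andP[N1 N2] := truncn_itv mL0; rewrite -/N in N1 N2.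
have er0 : 0 <= er by rewrite mulr_ge0 // exprn_ge0 // ltW.
have Ner : N%:R * er <= eta.
  apply: le_trans hm1; apply: le_trans (ler_wpM2r er0 N1) _.
  by rewrite le_eqVlt; apply/orP; left; apply/eqP; rewrite /er; ring.
have VN : V ^+ N * u^-1 ^+ m <= phi ^+ m.
  have -> : u^-1 = expR (- ln u) by rewrite expRN lnK // posrE.
  rewrite VE /phi -!expRM_natl -expRD ler_expR !mulrA mulrN -mulNr -mulrDl ler_wpM2r ?(ltW lu) //.
  have : N%:R * L1 <= m%:R / L2 * L1 by rewrite ler_wpM2r // ltW.
  rewrite [leLHS]mulrC; lra.
have VN0 : 0 <= V ^+ N * u^-1 ^+ m.
  by rewrite mulr_ge0 ?exprn_ge0 ?invr_ge0 ?(ltW u0) // (le_trans ler01).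
pose T := bmultinom d m.+1.
have trunc1 z : (forall j, normc (z j) = 1) -> normc (trunc m c z) <= 1 + er.
  move=> z1; have zu j : normc (z j) <= u by rewrite z1 ltW.
  have := le_normcB (Phi (\row_j z j)) (Phi (\row_j z j) - trunc m c z).
  rewrite opprB addrC subrK Phi_torus => [|j]; last by rewrite mxE z1.
  have := herr m z zu; rewrite -/er; lra.
have trunc1' z : (forall j, normc (z j) = 1) -> 1 - er <= normc (trunc m c z).
  move=> z1; have zu j : normc (z j) <= u by rewrite z1 ltW.
  have := le_normcD (trunc m c z) (Phi (\row_j z j) - trunc m c z).
  rewrite addrC subrK Phi_torus => [|j]; last by rewrite mxE z1.
  have := herr m z zu; rewrite -/er; lra.
have truncu z : (forall j, normc (z j) = u) -> normc (trunc m c z) <= V * (1 + er).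
  move=> z1; have zu j : normc (z j) <= u by rewrite z1.
  have := le_normcB (Phi (\row_j z j)) (Phi (\row_j z j) - trunc m c z).
  rewrite opprB addrC subrK.
  have -> : \row_j z j = dilate u (\row_j (u^-1%:C * z j)).
    by apply/rowP => j; rewrite !mxE mulrA -rmorphM divff ?mul1r // gt_eqF.
  have hV : normc (Phi (dilate u (\row_j (u^-1%:C * z j)))) <= V.
    apply: uV => j; rewrite mxE Normc.normcM z1 normcR gtr0_norm ?invr_gt0 //.
    by rewrite mulVf // gt_eqF.
  have := herr m z zu; rewrite -/er.
  have -> : \row_j z j = dilate u (\row_j (u^-1%:C * z j)).
    by apply/rowP => j; rewrite !mxE mulrA -rmorphM divff ?mul1r // gt_eqF.
  (* As V >= 1, the error is absorbed into the factor V (1 + er); the N-th power then separates into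
     V^N and the harmless (1 + er)^N. *)
  have : er <= V * er by rewrite ler_peMl.
  rewrite mulrDr mulr1; lra.
pose S := \sum_(z : T) normc (c (bmnm z)) ^+ 2.
have S1 : S <= 1.
  by have := coef_sqr_sum_le s_gt1 Phi_c Phi_torus (degset m); rewrite sum_degset.
have S0 : 0 <= S by apply: sumr_ge0 => z _; exact: sqr_ge0.
(* The truncation has modulus at least 1 - er on the torus, so Parseval gives S >= (1 - er)^2 when
   er <= 1. *)
have S2 : 1 - S <= 2 * er.
  have [e1|e1] := ltP 1 er; first lra.
  have : (1 - er) ^+ 2 <= S.
    rewrite /S -(sum_degset m (fun b => normc (c b) ^+ 2)); apply: sum_sqr_coef_ge.
    - exact: fset_uniq.
    - by rewrite subr_ge0.
    by move=> z /trunc1'; rewrite sum_degset.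
  have : 0 <= er ^+ 2 by exact: sqr_ge0.
  rewrite sqrrB expr1n mul1r; lra.
have uV2 : \sum_(z : T) (normc (c (bmnm z)) * u ^+ mdeg (bmnm z)) ^+ 2 <= V ^+ 2.
  have us0 : 0 < u < s by rewrite u0.
  by have := dilate_sqr_sum_le Phi_c (degset m) us0 uV; rewrite sum_degset.
have SN k : (k <= N)%N -> 1 - 2 * eta <= S ^+ k.
  move=> kN; have S01 : 0 <= S <= 1 by rewrite S0.
  apply: le_trans (bernoulli_ge k S01); rewrite lerD2l lerN2.
  apply: (@le_trans _ _ (N%:R * (2 * er))).
    by apply: ler_pM; rewrite ?ler0n ?subr_ge0 ?ler_nat.
  by rewrite mulrCA ler_pM2l.
have tt : (V ^+ N * u^-1 ^+ m) ^+ 2 <= eta.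
  have p1 : phi ^+ m <= 1 by case/andP: phi01 => p0 /ltW p1; rewrite exprn_ile1.
  apply: (@le_trans _ _ (V ^+ N * u^-1 ^+ m)); last exact: le_trans VN hm2.
  by rewrite expr2 ler_piMl // (le_trans VN).
(* Tangency at x0 = h/L2, the limit of N h/(m+1), makes the bracket 1 - x0 + N h/(m+1) tend to 1,
   leaving exp(x0). *)
have := @entropy_sum_ge R d N m c c1 u V u1 uV2 S1 B x0 m0 Bm.
rewrite -/S -/h -/K /=; set t := (_ * _) ^+ 2 in tt *; set rhs := \sum_(_ | _) _ => hY.
have NL : N%:R / m.+1%:R <= L2^-1.
  rewrite ler_pdivrMr ?ltr0n //; apply: le_trans N1 _.
  by rewrite mulrC ler_wpM2l ?(ltW Li0) // ler_nat.
have NL' : L2^-1 - (L2^-1 + 1) * eta <= N%:R / m.+1%:R.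
  apply: (@le_trans _ _ (L2^-1 - (L2^-1 + 1) * m.+1%:R^-1)).
    by rewrite lerD2l lerN2 ler_wpM2l // addr_ge0 // ltW.
  have mp : 0 < m.+1%:R :> R by rewrite ltr0n.
  rewrite ler_pdivlMr // mulrBl -mulrA mulVf ?gt_eqF // mulr1.
  move: N2; rewrite -!natr1 => N2; lra.
have N0 : 0 <= N%:R / m.+1%:R :> R by rewrite divr_ge0 ?ler0n.
have hh : h * (1 - 2 * eta) - K * eta <= h * S ^+ N.-1 - K * t.
  by apply: lerB; [rewrite ler_wpM2l // SN // leq_pred|rewrite ler_wpM2l].
have kap : expR (- e) <= 1 - x0 - `|1 - x0| * (1 - S ^+ N + t) +
             N%:R / m.+1%:R * (h * S ^+ N.-1 - K * t).
  apply: (@le_trans _ _ (1 - eta * Q)); first by lra.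
  have g1 : `|1 - x0| * (1 - S ^+ N + t) <= `|1 - x0| * (3 * eta).
    by rewrite ler_wpM2l //; have := SN N (leqnn _); lra.
  have g2 : N%:R / m.+1%:R * (h * (1 - 2 * eta) - K * eta) <=
      N%:R / m.+1%:R * (h * S ^+ N.-1 - K * t) by rewrite ler_wpM2l.
  have g3 : N%:R / m.+1%:R * ((2 * h + K) * eta) <= L2^-1 * ((2 * h + K) * eta).
    by rewrite ler_wpM2r // mulr_ge0 ?(ltW eta0) // addr_ge0 // mulr_ge0.
  have g4 : (L2^-1 - (L2^-1 + 1) * eta) * h <= N%:R / m.+1%:R * h by rewrite ler_wpM2r.
  have x0E : x0 = L2^-1 * h by rewrite /x0 mulrC.
  move: g1 g2 g3 g4; rewrite /Q; set nn := N%:R / _; set ab := `|1 - x0|.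
  set z1 := nn * (h * S ^+ N.-1 - K * t); set z2 := ab * (1 - S ^+ N + t).
  rewrite {1}x0E => g1 g2 g3 g4; lra.
have Y0 : 0 < expR (x0 - e) by exact: expR_gt0.
have hY' : expR (x0 - e) <= rhs.
  by apply: le_trans hY; rewrite expRD ler_wpM2l ?expR_ge0.
have := bh_const_ge u1 trunc1 truncu m0 Y0 hY'.
apply: le_trans; rewrite lee_fin.
set nB := _ + _ / _.
have nBe : nB <= expR e.
  apply: (@le_trans _ _ ((1 + er) ^+ N * (1 + phi ^+ m / (u - 1)))).
    rewrite /nB [leRHS]mulrDr mulr1 lerD2l exprMn.
    have -> : V ^+ N * (1 + er) ^+ N * u^-1 ^+ m / (u - 1) =
      (1 + er) ^+ N * (V ^+ N * u^-1 ^+ m / (u - 1)) by ring.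
    rewrite ler_wpM2l ?exprn_ge0 ?addr_ge0 //.
    by rewrite ler_wpM2r // invr_ge0 ltW.
  apply: (@le_trans _ _ (expR (N%:R * er) * expR (phi ^+ m / (u - 1)))).
    have phim0 : 0 <= phi ^+ m by rewrite exprn_ge0 // expR_ge0.
    have i0 : 0 <= (u - 1)^-1 by rewrite invr_ge0 ltW.
    have A1 : 0 <= (1 + er) ^+ N by rewrite exprn_ge0 // addr_ge0.
    have A2 : 0 <= 1 + phi ^+ m / (u - 1) by rewrite addr_ge0 // mulr_ge0.
    apply: (ler_pM A1 A2); last exact: expR_ge1Dx.
    by rewrite expRM_natl lerXn2r ?nnegrE ?addr_ge0 ?expR_ge0 // expR_ge1Dx.
  rewrite -expRD ler_expR; apply: le_trans etae; apply: lerD => //.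
  by rewrite ler_wpM2r // invr_ge0 ltW.
have nB0 : 0 < nB.
  rewrite /nB ltr_pwDl //; first by rewrite exprn_gt0 // ltr_pwDl.
  by rewrite !mulr_ge0 ?exprn_ge0 ?mulr_ge0 ?addr_ge0 ?invr_ge0 ?(ltW u0) ?(ltW um0) ?(le_trans ler01 V1).
rewrite ler_pdivlMr //; apply: (@le_trans _ _ (expR y * expR e)).
  by rewrite ler_wpM2l ?expR_ge0.
rewrite -expRD /powR gt_eqF // expRK ler_expR.
have -> : (bh_exponent R m)^-1 = 2^-1 + (2 * m%:R)^-1.
  rewrite /bh_exponent natrM -[m.+1%:R]natr1 invf_div mulrDl mul1r invfM mulrCA divff ?mulr1 //.
  by rewrite pnatr_eq0 -lt0n.
have m1' : 1 <= m%:R :> R by rewrite ler1n.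
have q1 : (2 * m%:R)^-1 <= 2^-1 :> R.
  by rewrite lef_pV2 ?posrE ?mulr_gt0 ?ltr0n //; lra.
have q0 : 0 <= (2 * m%:R)^-1 :> R by rewrite invr_ge0 mulr_ge0 ?ler0n.
have yE : y = x0 / 2 - 2 * e by rewrite /e; lra.
have g1 : 0 <= (2 * m%:R)^-1 * x0 by rewrite mulr_ge0.
have g2 : (2 * m%:R)^-1 * e <= 2^-1 * e by rewrite ler_wpM2r // ltW.
rewrite mulrDl !mulrBr; lra.
Qed.

End LowerBound.

(** * Lower limits and sums in the extended reals *)

Section ExtendedReals.
Variable R : realType.
Local Open Scope ereal_scope.

Lemma le_ereal_real_below (x z : \bar R) :
  (forall y : R, y%:E < x -> y%:E <= z) -> x <= z.
Proof.
move=> h; rewrite leNgt; apply/negP; move: x z h => [r| |] [r'| |] //= h.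
- rewrite lte_fin => rr; have := h ((r + r') / 2)%R; rewrite lte_fin lee_fin => h'.
  have : ((r + r') / 2 <= r')%R by apply: h'; lra.
  lra.
- by move=> _; have := h (r - 1)%R; rewrite lte_fin leeNy_eq => /(_ _)/eqP; rewrite ltrBlDr ltrDl ltr01 => /(_ isT).
- by move=> _; have := h (r' + 1)%R (ltry _); rewrite lee_fin gerDl ler10.
- by move=> _; have := h 0%R (ltry _); rewrite leeNy_eq.
Qed.

Lemma le_limn_einf (x : \bar R) (v : nat -> \bar R) :
  (forall y : R, y%:E < x -> exists m0, forall m, (m0 <= m)%N -> y%:E <= v m) ->
  x <= limn_einf v.
Proof.
move=> h; apply: le_ereal_real_below => y /h[m0 hm]; rewrite leeNr -EFinN.
apply: ereal_inf_le; exists (ereal_sup ((\- v) @` [set m | (m0 <= m)%N])).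
  by exists [set m | (m0 <= m)%N] => //; exists m0.
by apply: ge_ereal_sup => _ [m /= mm <-]; rewrite EFinN leeN2 hm.
Qed.

Lemma lt_esum_fset (T : choiceType) (f : T -> R) (y : R) : (forall t, 0 <= f t)%R ->
  y%:E < \esum_(t in [set: T]) (f t)%:E ->
  exists B : {fset T}, (y < \sum_(t <- enum_fset B) f t)%R.
Proof.
move=> f0 /ereal_sup_gt[_ [A [finA _] <-]].
by rewrite fsbig_finite //= sumEFin lte_fin => h; exists (fset_set A).
Qed.

End ExtendedReals.

(** * Entropy and radial index of an inner function *)

Section InnerFunction.
Variables (R : realType) (d : nat) (Phi : 'rV[R[i]^o]_d -> R[i]).
Local Notation normc := (@Normc.normc R).
Local Notation point := 'rV[R[i]^o]_d.
Local Notation c := (taylor_coef Phi).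
Hypothesis d_ge1 : (1 <= d)%N.
Hypothesis Phi_inner : rational_inner Phi.
Hypothesis Phi_analytic : analytic_near_closed_polydisc Phi.

Lemma inner_expands : exists2 s : R, 1 < s & expands (fun w => Phi (\row_j w j)) c s.
Proof. exact: analytic_expands (taylor_coef_series Phi_analytic). Qed.

Lemma inner_torus (z : point) : (forall j, normc (z 0 j) = 1) -> normc (Phi z) = 1.
Proof.
have [s s1 cs] := inner_expands; case: Phi_inner => _ _ ae.
exact: (torus_norm1 cs s1 ae).
Qed.

Lemma inner_coef_le1 b : normc (c b) <= 1.
Proof. by have [s s1 cs] := inner_expands; exact: coef_le1 s1 cs inner_torus b. Qed.

(** If all coefficients other than the constant one vanished, the Taylor series would make Phi
    constant on the polydisc; so some index of positive degree makes the radial index positive. *)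
Lemma radial_index_pos : ~ constant_on_polydisc Phi ->
  exists2 l : R, 0 < l & radial_index Phi = l%:E.
Proof.
move=> Phi_nonconstant; have [s s1 cs] := inner_expands.
have [a a0 ca] : exists2 a, a != @mnm0 d & c a != 0.
  apply: contrapT => h; apply: Phi_nonconstant; exists (c (@mnm0 d)) => z hz.
  have cz a : a \notin fset1 (@mnm0 d) -> c a * mono (fun j => z 0 j) a = 0.
    rewrite inE => a0; have [->|ca] := eqVneq (c a) 0; first by rewrite mul0r.
    by case: h; exists a.
  have := has_sum_fin cz; rewrite big_seq_fset1 [mono _ _]big1 ?mulr1 => [h1|j _];
    last by rewrite mnm0E.
  have zE : (\row_j z 0 j) = z by apply/rowP => j; rewrite mxE.
  rewrite -zE; apply: has_sum_unique (cs.2 (fun j => z 0 j) _) h1 => j.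
  by apply: lt_trans (hz j) s1.
have := radial_index_gt0 s1 cs inner_torus a0 ca.
have [K] := radial_index_le s1 cs inner_torus d_ge1.
by case: (radial_index Phi) => // l _; rewrite lte_fin => l0; exists l.
Qed.

Let term b := normc (c b) ^+ 2 * surprisal c b.

Let term_ge0 b : 0 <= term b.
Proof. by rewrite mulr_ge0 ?sqr_ge0 // (surprisal_ge0 inner_coef_le1). Qed.

Let coef_entropyE : coef_entropy Phi = \esum_(b in [set: multinom d]) (term b)%:E.
Proof. by apply: eq_esum => b _; rewrite /term mulrN. Qed.

Lemma coef_entropy_ge0 : (0 <= coef_entropy Phi)%E.
Proof. by rewrite coef_entropyE; apply: esum_ge0 => b _; rewrite lee_fin. Qed.

Lemma bh_const_eventually_ge (l y : R) : 0 < l -> radial_index Phi = l%:E ->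
  (y%:E < coef_entropy Phi * ((2 * l)^-1)%:E)%E ->
  exists m0, forall m, (m0 <= m)%N -> ((expR y)%:E <= bh_const R m)%E.
Proof.
move=> l0 lE yx; have [s s1 cs] := inner_expands.
have l2 : 0 < 2 * l by rewrite mulr_gt0.
have yh : ((y * (2 * l))%:E < coef_entropy Phi)%E.
  have : (y%:E * (2 * l)%:E < coef_entropy Phi * ((2 * l)^-1)%:E * (2 * l)%:E)%E.
    by rewrite lte_pmul2r // lte_fin.
  by rewrite -muleA -!EFinM mulVf ?gt_eqF // mule1.
rewrite coef_entropyE in yh; have [B hB] := lt_esum_fset term_ge0 yh.
set g := \sum_(_ <- _) _ in hB.
(* With L2 = l + 2e the requirement is 2 y l + 4 y e < g; this e makes 4 |y| e smaller than g - 2 y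
   l. *)
pose e := (g - y * (2 * l)) / (8 * (`|y| + 1)).
have y1 : 0 < `|y| + 1 by rewrite ltr_wpDl.
have e0 : 0 < e by rewrite divr_gt0 ?mulr_gt0 // subr_gt0.
have eE : e * (8 * (`|y| + 1)) = g - y * (2 * l) by rewrite divfK // gt_eqF // mulr_gt0.
have ye : y * e <= `|y| * e by rewrite ler_wpM2r ?ler_norm // ltW.
apply: (@bh_const_lower _ _ Phi c s s1 cs inner_torus (l + e) (l + 2 * e) y B).
- by rewrite lE lte_fin ltrDl.
- by rewrite addr_gt0.
- by lra.
by rewrite -/g ltr_pdivlMr // ltr_pdivlMr; nra.
Qed.

(** A term of the entropy vanishes exactly when the coefficient has modulus 0 or 1. The total mass 1
    excludes two unimodular coefficients, and a lone nonzero coefficient has modulus |Phi(1, ...,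
    1)| = 1. *)
Lemma coef_entropy_gt0 : (0 < coef_entropy Phi)%E <-> ~ is_monomial Phi.
Proof.
have [s s1 cs] := inner_expands.
have one1 j : normc ((\row_(j < d) (1 : R[i]) : point) 0 j) = 1.
  by rewrite mxE Normc.normc1.
split=> [hpos [b [cb hb]]|nm].
  have c0 b' : b' != b -> c b' = 0.
    by move=> bb; apply: contrapT => /hb e; rewrite e eqxx in bb.
  have cb1 : normc (c b) = 1.
    rewrite -(inner_torus one1); congr normc.
    have cz b' : b' \notin fset1 b -> c b' * mono (fun=> 1) b' = 0.
      by rewrite inE => /c0 ->; rewrite mul0r.
    have := has_sum_fin cz; rewrite big_seq_fset1 [mono _ _]big1 ?mulr1 => [h1|j _];
      last by rewrite expr1n.
    by apply: has_sum_unique h1 (cs.2 (fun=> 1) _) => j; rewrite Normc.normc1.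
  move: hpos; rewrite coef_entropyE esum1 ?ltxx // => b' _; congr EFin.
  rewrite /term /surprisal; have [->|/c0 ->] := eqVneq b' b.
    by rewrite cb1 expr1n ln1 oppr0 mulr0.
  by rewrite Normc.normc0 expr0n mul0r.
have [b [b0 b1]] : exists b, c b <> 0 /\ normc (c b) <> 1.
  apply: contrapT => hn.
  have cn b : c b <> 0 -> normc (c b) = 1.
    by move=> b0; apply: contrapT => b1; apply: hn; exists b.
  have [a ca] : exists a, c a <> 0.
    apply: contrapT => c0; have := inner_torus one1.
    have cz b : c b * mono (fun=> 1) b = 0.
      by have [->|/eqP cb] := eqVneq (c b) 0; [rewrite mul0r|case: c0; exists b].
    have := @has_sum_fin _ _ (fun b => c b * mono (fun=> 1) b) fset0 (fun b _ => cz b).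
    rewrite big_seq_fset0 => /(has_sum_unique (cs.2 (fun=> 1) _)) ->.
      by rewrite Normc.normc0 => /eqP; rewrite eq_sym oner_eq0.
    by move=> j; rewrite Normc.normc1.
  apply: nm; exists a; split=> // b /cn b1; apply: contrapT => /eqP ab.
  have := coef_sqr_sum_le s1 cs inner_torus (fsetU (fset1 a) (fset1 b)).
  rewrite (big_fsetD1 a) ?inE ?eqxx //= (cn a) // expr1n.
  rewrite (big_fsetD1 b) /=; last by rewrite !inE eqxx orbT andbT eq_sym.
  rewrite b1 expr1n; set z := \sum_(_ <- _) _.
  have : 0 <= z by apply: sumr_ge0 => b' _; exact: sqr_ge0.
  lra.
have nb0 : 0 < normc (c b) by rewrite normc_gt0; exact/eqP.
have nb1 : normc (c b) < 1 by rewrite lt_neqAle inner_coef_le1 andbT; exact/eqP.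
apply: (@lt_le_trans _ _ (term b)%:E).
  rewrite lte_fin /term mulr_gt0 ?exprn_gt0 // oppr_gt0 ln_lt0 // exprn_gt0 //=.
  by rewrite expr_lt1 // ltW.
rewrite coef_entropyE; apply: esum_ge; exists [set b].
  by split => //; exact: finite_set1.
by rewrite fsbig_set1.
Qed.

End InnerFunction.

Local Open Scope ereal_scope.

Theorem theorem6p6 (R : realType) (d : nat) (Phi : 'rV[R[i]^o]_d -> R[i])
    (d_ge1 : (1 <= d)%N)
    (Phi_inner : rational_inner Phi)
    (Phi_nonconstant : ~ constant_on_polydisc Phi)
    (Phi_analytic : analytic_near_closed_polydisc Phi) :
  [/\ coef_entropy Phi / (2%:E * radial_index Phi)
        <= limn_einf (fun m => lne (bh_const R m)),
      expeR (coef_entropy Phi / (2%:E * radial_index Phi))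
        <= limn_einf (fun m => bh_const R m)
    & 1 < expeR (coef_entropy Phi / (2%:E * radial_index Phi))
        <-> ~ is_monomial Phi].
Proof.
have [l l0 lE] := radial_index_pos d_ge1 Phi_inner Phi_analytic Phi_nonconstant.
have lower y := @bh_const_eventually_ge _ _ _ Phi_inner Phi_analytic l y l0 lE.
have li : (0 < (2 * l)^-1)%R by rewrite invr_gt0 mulr_gt0.
have -> : coef_entropy Phi / (2%:E * radial_index Phi) =
    coef_entropy Phi * ((2 * l)^-1)%:E.
  by rewrite lE -EFinM inver gt_eqF // mulr_gt0.
set x := _ * _ in lower *.
have x0 : 0 <= x by rewrite mule_ge0 ?(coef_entropy_ge0 Phi_inner) // lee_fin ltW.
split.
- apply: le_limn_einf => y /lower[m0 hm]; exists m0 => m /hm h1.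
  have e0 := expR_gt0 y.
  rewrite -[y]expRK -lne_EFin // lee_lne // in_itv /= ?lee_fin ?(ltW e0) ?leey //.
  by rewrite andbT (le_trans _ h1) // lee_fin ltW.
- apply: le_limn_einf => y yx; have [y0|y0] := leP y 0%R.
    have [|m0 hm] := lower (- 1)%R; first by rewrite (lt_le_trans _ x0) // lte_fin ltrN10.
    exists m0 => m /hm; apply: le_trans; rewrite lee_fin (le_trans y0) // expR_ge0.
  have [|m0 hm] := lower (ln y); first by rewrite -lte_expeR /= lnK.
  by exists m0 => m /hm; rewrite lnK.
rewrite -[1]expeR0 lte_expeR /x pmule_lgt0 ?lte_fin //.
exact: coef_entropy_gt0 Phi_inner Phi_analytic.
Qed.
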